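(* There is a polynomial-time reduction from $\mathsf{PrivateMNW}$ to $\mathsf{PublicMNW}$: there is a polynomial-time algorithm that, given any instance $\mathcal I$ of the private goods model, constructs an instance $\mathcal I'$ of the public goods model, such that from any MNW allocation of $\mathcal I'$ one can compute in polynomial time an MNW allocation of $\mathcal I$.
   Context: Private goods model: agents $[n]$, goods $[m]$, nonnegative integer additive values $v_{ij}$; a feasible allocation is a partition $(x_1,\dots,x_n)$ of $[m]$, agent $i$ receiving utility $v_i(x_i)=\sum_{j\in x_i}v_{ij}$. Public goods model: agents $[n]$, goods $[m]$, an integer $0\le k\le m$, nonnegative integer additive values $v_{ij}$; a feasible allocation is a subset $x\subseteq[m]$ with $|x|\le k$, each agent $i$ receiving $v_i(x)=\sum_{j\in x}v_{ij}$. In either model the Nash welfare of a feasible allocation is $\mathrm{NW}(x)=(\prod_i v_i(x))^{1/n}$ (with $v_i(x)$ meaning $v_i(x_i)$ in the private model); an MNW allocation maximizes NW, where, if every feasible allocation has NW equal to $0$, an MNW allocation is one that maximizes the number of agents with positive utility and, subject to that, maximizes the product of the positive utilities. $\mathsf{PrivateMNW}$ ($\mathsf{PublicMNW}$) is the problem of computing an MNW allocation in the private (public) goods model. *)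

(* Defs.v *)
From mathcomp Require Import all_boot.
Set Implicit Arguments. Unset Strict Implicit. Unset Printing Implicit Defensive.

(* value table: row i = values of agent i; v_ij = nth 0 (nth [::] v i) j *)
Definition val (v : seq (seq nat)) (i j : nat) : nat := nth 0 (nth [::] v i) j.

Record priv_inst := PrivInst { pr_n : nat; pr_m : nat; pr_v : seq (seq nat) }.
Record pub_inst := PubInst { pu_n : nat; pu_m : nat; pu_k : nat; pu_v : seq (seq nat) }.

Definition priv_wf (I : priv_inst) : Prop :=
  0 < pr_n I /\ size (pr_v I) = pr_n I /\ all (fun r => size r == pr_m I) (pr_v I).
Definition pub_wf (I : pub_inst) : Prop :=
  size (pu_v I) = pu_n I /\ all (fun r => size r == pu_m I) (pu_v I) /\ pu_k I <= pu_m I.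

(* private allocation = partition of [m] into bundles x_1..x_n, represented by
   the owner list a (good j belongs to agent nth 0 a j) *)
Definition priv_feasible (I : priv_inst) (a : seq nat) : Prop :=
  size a = pr_m I /\ all (fun i => i < pr_n I) a.
Definition priv_util (I : priv_inst) (a : seq nat) (i : nat) : nat :=
  \sum_(j < pr_m I | nth 0 a j == i) val (pr_v I) i j.

(* public allocation = subset x of [m] with |x| <= k, represented by its
   indicator list *)
Definition pub_feasible (I : pub_inst) (x : seq bool) : Prop :=
  size x = pu_m I /\ count id x <= pu_k I.
Definition pub_util (I : pub_inst) (x : seq bool) (i : nat) : nat :=
  \sum_(j < pu_m I | nth false x j) val (pu_v I) i j.

(* NW(x) = (prod_i u_i)^(1/n); since t |-> t^(1/n) is increasing on      *)
(* nonnegative reals, maximizing NW = maximizing the product.            *)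
Section MNW.
Variables (A : Type) (n : nat) (F : A -> Prop) (u : A -> nat -> nat).
Definition prodU (x : A) : nat := \prod_(i < n) u x i.
Definition npos (x : A) : nat := #|[set i : 'I_n | 0 < u x i]|.
Definition prodpos (x : A) : nat := \prod_(i < n | 0 < u x i) u x i.
Definition is_MNW (x : A) : Prop :=
  F x /\
  ((exists y, F y /\ 0 < prodU y) -> forall y, F y -> prodU y <= prodU x) /\
  (~ (exists y, F y /\ 0 < prodU y) ->
     forall y, F y -> npos y <= npos x /\ (npos y = npos x -> prodpos y <= prodpos x)).
End MNW.

Definition priv_MNW (I : priv_inst) (a : seq nat) : Prop :=
  is_MNW (pr_n I) (priv_feasible I) (priv_util I) a.
Definition pub_MNW (I : pub_inst) (x : seq bool) : Prop :=
  is_MNW (pu_n I) (pub_feasible I) (pub_util I) x.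

Definition nat_bits (n : nat) : seq bool :=
  if n is 0 then [::] else [seq odd (n %/ 2 ^ i) | i <- iota 0 (trunc_log 2 n).+1].
(* self-delimiting: each bit b as [true; b], terminator [false; false] *)
Definition enc_nat (n : nat) : seq bool :=
  flatten [seq [:: true; b] | b <- nat_bits n] ++ [:: false; false].
Definition enc_seq (T : Type) (e : T -> seq bool) (s : seq T) : seq bool :=
  enc_nat (size s) ++ flatten (map e s).

Definition enc_priv (I : priv_inst) : seq bool :=
  enc_nat (pr_n I) ++ enc_nat (pr_m I) ++ enc_seq (enc_seq enc_nat) (pr_v I).
Definition enc_pub (I : pub_inst) : seq bool :=
  enc_nat (pu_n I) ++ enc_nat (pu_m I) ++ enc_nat (pu_k I)
    ++ enc_seq (enc_seq enc_nat) (pu_v I).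
Definition enc_priv_alloc (a : seq nat) : seq bool := enc_seq enc_nat a.
Definition enc_pub_alloc (x : seq bool) : seq bool := enc_seq (fun b : bool => enc_nat (nat_of_bool b)) x.

Inductive tm_dir := MoveL | MoveR | Stay.

(* states 'I_(Q+1), start state 0; blank = None; halts when delta = None *)
Unset Implicit Arguments.
Record TM := MkTM {
  tm_Q : nat;
  tm_delta : 'I_tm_Q.+1 -> option bool -> option ('I_tm_Q.+1 * option bool * tm_dir) }.

Set Implicit Arguments.
Definition config (M : TM) : Type :=
  ('I_(tm_Q M).+1 * seq (option bool) * option bool * seq (option bool))%type.

Definition tm_step (M : TM) (c : config M) : option (config M) :=
  let: (q, l, s, r) := c in
  match tm_delta M q s with
  | None => None
  | Some (q', w, d) =>
    Some (match d with
          | Stay => (q', l, w, r)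
          | MoveL => match l with
                     | [::] => (q', [::], None, w :: r)
                     | a :: l' => (q', l', a, w :: r) end
          | MoveR => match r with
                     | [::] => (q', w :: l, None, [::])
                     | a :: r' => (q', w :: l, a, r') end
          end)
  end.

Fixpoint tm_run (M : TM) (t : nat) (c : config M) : option (config M) :=
  match t with
  | 0 => Some c
  | t'.+1 => match tm_step c with None => None | Some c' => tm_run t' c' end
  end.

Definition tm_init (M : TM) (w : seq bool) : config M :=
  (@ord0 (tm_Q M), [::], head None (map Some w), behead (map Some w)).

Fixpoint read_bits (s : seq (option bool)) : seq bool :=
  match s with Some b :: s' => b :: read_bits s' | _ => [::] end.

Definition tm_output (M : TM) (c : config M) : seq bool :=
  let: (_, _, s, r) := c in read_bits (s :: r).

Definition halts_within (M : TM) (w : seq bool) (t : nat) (out : seq bool) : Prop :=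
  exists t', t' <= t /\ exists c, tm_run t' (tm_init M w) = Some c /\
    tm_step c = None /\ tm_output c = out.

Definition poly_time (A B : Type) (encA : A -> seq bool) (encB : B -> seq bool)
  (P : A -> Prop) (f : A -> B) : Prop :=
  exists (M : TM) (c d : nat), forall a, P a ->
    halts_within M (encA a) (c * (size (encA a)).+1 ^ d) (encB (f a)).

(* Main.v *)
(* Give the public instance one good for every pair of a private good j and an agent i,
   allow as many chosen goods as there are private goods, and add n + 1 identical agents
   for each private good j, who want any of its n copies. Covering one more private good
   outweighs all n original agents, so an MNW allocation covers every private good, hence
   exactly once: it is a partition. The added agents then contribute a constant to the
   number of positive utilities and a factor 1 to the products.

   For the polynomial time bounds, both maps are written as programs over finitely many
   stacks of bits; the stacks are interleaved on the single tape of a Turing machine,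
   where one stack operation costs a number of steps linear in the stack sizes. *)

From Stdlib Require Import ZArith.
Require Import Defs.
From mathcomp Require Import all_boot.
From mathcomp Require Import zify.

Set Implicit Arguments.
Unset Strict Implicit.
Unset Printing Implicit Defensive.

(** * Turing machines from structured programs *)

(** The number n + 1 of added agents per good comes from the degenerate case. When the product can
    be positive, positivity alone forces every good to be covered. When it cannot, only the count of
    positive utilities speaks for covering, and leaving one good uncovered loses all its added
    agents while it gains at most the n original ones. The two cases correspond on both sides, since
    a public allocation with positive product is itself a partition. The obstacle to polynomial time
    is that the values are written in binary and may be exponential in the length of the input, so
    they are only copied or skipped digit by digit. The sizes n and m are bounded by that length,
    because the table lists n rows of m values each and n > 0; they and the numbers computed from
    them are kept in unary, where loops, sums and products need no arithmetic. *)

Definition tape := Z -> option bool.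
Definition twrite (T : tape) (h : Z) (w : option bool) : tape :=
  fun z => if Z.eqb z h then w else T z.
Definition dmove (d : tm_dir) (h : Z) : Z :=
  match d with MoveL => (h - 1)%Z | MoveR => (h + 1)%Z | Stay => h end.

Variant instr :=
  | IMove of tm_dir
  | IWrite of option bool
  | IJump of (option bool -> nat).
Definition code := seq instr.
Definition istate := (nat * tape * Z)%type.

(* Running past the end of the code is halting, so [astep] is total. *)
Definition astep (c : code) (x : istate) : istate :=
  let: (q, T, h) := x in
  if q < size c then
    match nth (IMove Stay) c q with
    | IMove d => (q.+1, T, dmove d h)
    | IWrite w => (q.+1, twrite T h w, h)
    | IJump f => (minn (f (T h)) (size c), T, h)
    end
  else x.

(** The states are the addresses [0] to [size c], the last one being the halting state; [minn]
    clamps jumps so that [inord] always receives a valid address. *)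
Definition tm_of (c : code) : TM :=
  @MkTM (size c) (fun q s =>
    if q < size c then
      Some match nth (IMove Stay) c q with
           | IMove d => (inord q.+1, s, d)
           | IWrite w => (inord q.+1, w, Stay)
           | IJump f => (inord (minn (f s) (size c)), s, Stay)
           end
    else None).

(** A relation rather than a function, because a configuration may carry any number of trailing
    blanks in its two lists; the default [None] of [nth] identifies them. *)
Definition mirrors (c : code) (x : istate) (y : config (tm_of c)) : Prop :=
  let: (q, T, h) := x in
  let: (q', l, s, r) := y in
  [/\ q = q', s = T h,
      forall i : nat, nth None r i = T (h + 1 + Z.of_nat i)%Z
    & forall i : nat, nth None l i = T (h - 1 - Z.of_nat i)%Z].

Lemma mirrors_step (c : code) x (y : config (tm_of c)) :
  mirrors x y -> x.1.1 < size c ->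
  exists y', tm_step y = Some y' /\ mirrors (astep c x) y'.
Proof.
case: x => [[q T] h]; case: y => [[[q' l] s] r] [-> -> Hr Hl] /= qc.
rewrite qc.
have inq (p : nat) : p <= size c -> nat_of_ord (inord p : 'I_(size c).+1) = p.
  by move=> pc; rewrite inordK.
case E: nth => [d|w|f].
- case: d E => E.
  + case: l Hl => [|a l] Hl; eexists; (split; [reflexivity|]).
    * split=> [||i|i]; rewrite ?inq //.
      -- by move: (Hl 0) => /= ->; apply: (congr1 T); rewrite /dmove; lia.
      -- by case: i => [|i] /=; rewrite ?Hr; apply: (congr1 T); rewrite /dmove; lia.
      -- by move: (Hl i.+1); rewrite !nth_nil => ->; apply: (congr1 T); rewrite /dmove; lia.
    * split=> [||i|i]; rewrite ?inq //.
      -- by move: (Hl 0) => /= ->; apply: (congr1 T); rewrite /dmove; lia.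
      -- by case: i => [|i] /=; rewrite ?Hr; apply: (congr1 T); rewrite /dmove; lia.
      -- by move: (Hl i.+1) => /= ->; apply: (congr1 T); rewrite /dmove; lia.
  + case: r Hr => [|a r] Hr; eexists; (split; [reflexivity|]).
    * split=> [||i|i]; rewrite ?inq //.
      -- by move: (Hr 0) => /= ->; apply: (congr1 T); rewrite /dmove; lia.
      -- by move: (Hr i.+1); rewrite !nth_nil => ->; apply: (congr1 T); rewrite /dmove; lia.
      -- by case: i => [|i] /=; rewrite ?Hl; apply: (congr1 T); rewrite /dmove; lia.
    * split=> [||i|i]; rewrite ?inq //.
      -- by move: (Hr 0) => /= ->; apply: (congr1 T); rewrite /dmove; lia.
      -- by move: (Hr i.+1) => /= ->; apply: (congr1 T); rewrite /dmove; lia.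
      -- by case: i => [|i] /=; rewrite ?Hl; apply: (congr1 T); rewrite /dmove; lia.
  + by eexists; (split; [reflexivity|]); split=> //; rewrite inq.
- eexists; (split; [reflexivity|]).
  split=> [||i|i]; rewrite /twrite ?inq ?Z.eqb_refl //.
  + by rewrite Hr; case: Z.eqb_spec => //; lia.
  + by rewrite Hl; case: Z.eqb_spec => //; lia.
- by eexists; (split; [reflexivity|]); split=> //; rewrite inq // geq_minr.
Qed.

(** The machine may make fewer steps than t: [astep] idles once the code is left, whereas [tm_run]
    has no step from a halted configuration. *)
Lemma mirrors_run (c : code) t x (y : config (tm_of c)) :
  mirrors x y -> exists2 t', t' <= t &
  exists2 y', tm_run t' y = Some y' & mirrors (iter t (astep c) x) y'.
Proof.
elim: t x y => [|t IH] x y xy; first by exists 0 => //; exists y.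
case: (ltnP x.1.1 (size c)) => qc.
  have [z [yz xz]] := mirrors_step xy qc.
  have [t' tt' [y' zy' xy']] := IH _ _ xz.
  by exists t'.+1 => //; exists y'; rewrite ?iterSr //= yz.
exists 0 => //; exists y => //.
suff -> : iter t.+1 (astep c) x = x by [].
apply: iter_fix.
by move: qc; case: x {xy} => [[q T] h] /= qc; rewrite ltnNge qc.
Qed.

Definition init_tape (w : seq bool) : tape :=
  fun z => if (z <? 0)%Z then None else nth None (map Some w) (Z.to_nat z).

(** The head has to end at cell 0, since [tm_output] reads from the head to the right, up to the
    first blank. *)
Lemma halts_of_run (c : code) (w out : seq bool) t T :
  iter t (astep c) (0, init_tape w, 0%Z) = (size c, T, 0%Z) ->
  (forall i : nat, T (Z.of_nat i) = nth None (map Some out) i) ->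
  halts_within (tm_of c) w t out.
Proof.
move=> Hrun Hout.
have m0 : mirrors (0, init_tape w, 0%Z) (tm_init (tm_of c) w).
  split=> // i.
  - rewrite /init_tape; case: Z.ltb_spec => [?|_]; first by lia.
    rewrite nth_behead; congr nth; lia.
  - by rewrite nth_nil /init_tape; case: Z.ltb_spec => //; lia.
have [t' tt' [y ry]] := mirrors_run t m0.
rewrite Hrun; case: y ry => [[[q l] s] r] ry [qs sT Hr Hl].
exists t'; split=> //; eexists; split; first exact: ry.
split; first by rewrite /= -qs ltnn.
rewrite /tm_output {}sT.
have {Hl Hr}: forall i, nth None (T 0%Z :: r) i = nth None (map Some out) i.
  case=> [|i]; rewrite -Hout //= Hr; apply: (congr1 T); rewrite /dmove; lia.
elim: (out) (_ :: r) => [|b o IH] [|a u] Hu //=.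
- by move: (Hu 0) => /= ->.
- by have := Hu 0.
- by move: (Hu 0) => /= ->; rewrite (IH u) // => i; apply: (Hu i.+1).
Qed.

(** * Structured tape programs and their compilation *)

Inductive lprog :=
  | LSkip
  | LMove of tm_dir
  | LWrite of option bool
  | LSeq of lprog & lprog
  | LIf of (option bool -> bool) & lprog & lprog
  | LWhile of (option bool -> bool) & lprog.

(** The times anticipate the compiled code: a test is one jump, a then-branch needs a second jump
    past the else-branch, and a loop round a second jump back to the test. *)
Inductive lexec : lprog -> tape -> Z -> nat -> tape -> Z -> Prop :=
  | lexec_skip T h : lexec LSkip T h 0 T h
  | lexec_move d T h : lexec (LMove d) T h 1 T (dmove d h)
  | lexec_write w T h : lexec (LWrite w) T h 1 (twrite T h w) h
  | lexec_seq p q T h t T1 h1 t1 T2 h2 :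
      lexec p T h t T1 h1 -> lexec q T1 h1 t1 T2 h2 ->
      lexec (LSeq p q) T h (t + t1) T2 h2
  | lexec_ift (f : option bool -> bool) p q T h t T1 h1 :
      f (T h) -> lexec p T h t T1 h1 -> lexec (LIf f p q) T h (t + 2) T1 h1
  | lexec_iff (f : option bool -> bool) p q T h t T1 h1 :
      ~~ f (T h) -> lexec q T h t T1 h1 -> lexec (LIf f p q) T h (t + 1) T1 h1
  | lexec_whilef (f : option bool -> bool) p T h : ~~ f (T h) -> lexec (LWhile f p) T h 1 T h
  | lexec_whilet (f : option bool -> bool) p T h t T1 h1 t1 T2 h2 :
      f (T h) -> lexec p T h t T1 h1 -> lexec (LWhile f p) T1 h1 t1 T2 h2 ->
      lexec (LWhile f p) T h (t + t1 + 2) T2 h2.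

(* [comp p o] is position dependent: [o] is the address of its first instruction. *)
Fixpoint comp (p : lprog) (o : nat) : code :=
  match p with
  | LSkip => [::]
  | LMove d => [:: IMove d]
  | LWrite w => [:: IWrite w]
  | LSeq p q => let cp := comp p o in cp ++ comp q (o + size cp)
  | LIf f p q =>
      let cp := comp p o.+1 in
      let o' := o + size cp + 2 in
      let cq := comp q o' in
      IJump (fun s => if f s then o.+1 else o')
        :: cp ++ IJump (fun _ => o' + size cq) :: cq
  | LWhile f p =>
      let cp := comp p o.+1 in
      IJump (fun s => if f s then o.+1 else o + size cp + 2)
        :: cp ++ [:: IJump (fun _ => o)]
  end.

(** Jump targets are absolute, so the induction needs the fragment in place, between an arbitrary
    prefix that fixes its address and an arbitrary suffix. *)
Lemma comp_run p T h t T' h' : lexec p T h t T' h' ->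
  forall pre post, let cp := comp p (size pre) in
  iter t (astep (pre ++ cp ++ post)) (size pre, T, h) = (size pre + size cp, T', h').
Proof.
have nthc pre x post : nth (IMove Stay) (pre ++ x :: post) (size pre) = x.
  by rewrite nth_cat ltnn subnn.
have ltc pre (x : instr) post : size pre < size (pre ++ x :: post).
  by rewrite size_cat /= addnS ltnS leq_addr.
elim=> {p T h t T' h'}.
- by move=> T h pre post /=; rewrite addn0.
- by move=> d T h pre post /=; rewrite ltc nthc addn1.
- by move=> w T h pre post /=; rewrite ltc nthc addn1.
- move=> p q T h t T1 h1 t1 T2 h2 _ IHp _ IHq pre post /=.
  set cp := comp p _; set cq := comp q _.
  rewrite addnC iterD -catA IHp.
  have := IHq (pre ++ cp) post; rewrite /= size_cat -!catA -/cq => ->.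
  by rewrite size_cat addnA.
- move=> f p q T h t T1 h1 fT _ IH pre post /=.
  set cp := comp p _; set cq := comp q _; set J1 := IJump _; set J2 := IJump _.
  rewrite addn2 iterSr /= ltc nthc /= fT.
  have := IH (rcons pre J1) (J2 :: cq ++ post).
  rewrite /= size_rcons -/cp cat_rcons -!catA => E.
  rewrite (minn_idPl _) ?ltc // E.
  have E2 : (size pre).+1 + size cp = size (pre ++ J1 :: cp).
    by rewrite size_cat /= addnS addSn.
  have EC rest : pre ++ J1 :: cp ++ J2 :: rest = (pre ++ J1 :: cp) ++ J2 :: rest.
    by rewrite -catA.
  rewrite E2 ?cat_cons EC /= ltc nthc /=.
  rewrite (minn_idPl _); last by rewrite !size_cat /= !size_cat; lia.
  by congr (_, _, _); rewrite size_cat /=; lia.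
- move=> f p q T h t T1 h1 /negbTE fT _ IH pre post /=.
  set cp := comp p _; set cq := comp q _; set J1 := IJump _; set J2 := IJump _.
  rewrite addn1 iterSr /= ltc nthc /= fT.
  have E2 : size pre + size cp + 2 = size (pre ++ J1 :: cp ++ [:: J2]).
    by rewrite size_cat /= size_cat /=; lia.
  have := IH (pre ++ J1 :: cp ++ [:: J2]) post.
  rewrite -E2 -/cq /= -!catA /= -!catA /= => E.
  rewrite (minn_idPl _); last by rewrite size_cat /= size_cat /=; lia.
  by rewrite E; congr (_, _, _); rewrite size_cat /=; lia.
- move=> f p T h /negbTE fT pre post /=.
  set cp := comp p _; set J1 := IJump _; set J2 := IJump _.
  rewrite ltc nthc /= fT (minn_idPl _).
    by congr (_, _, _); rewrite size_cat /=; lia.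
  by rewrite size_cat /= !size_cat /=; lia.
- move=> f p T h t T1 h1 t1 T2 h2 fT _ IH _ IHw pre post /=.
  set cp := comp p _; set J1 := IJump _; set J2 := IJump _.
  rewrite addn2 addnC -!addnS iterD iterSr /= ltc nthc /= fT.
  have := IH (rcons pre J1) (J2 :: post).
  rewrite /= size_rcons -/cp cat_rcons => E.
  rewrite -!catA /= (minn_idPl _) ?ltc // E.
  have E2 : (size pre).+1 + size cp = size (pre ++ J1 :: cp).
    by rewrite size_cat /= addnS addSn.
  have EC rest : pre ++ J1 :: cp ++ J2 :: rest = (pre ++ J1 :: cp) ++ J2 :: rest.
    by rewrite -catA.
  rewrite E2 ?cat_cons EC /= ltc nthc /=.
  rewrite (minn_idPl _); last by rewrite !size_cat; lia.
  have := IHw pre post.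
  rewrite /= -/cp -/J1 -/J2 -!catA /= => ->.
  by rewrite size_cat.
Qed.

Lemma lprog_halts p w out t T :
  lexec p (init_tape w) 0%Z t T 0%Z ->
  (forall i : nat, T (Z.of_nat i) = nth None (map Some out) i) ->
  halts_within (tm_of (comp p 0)) w t out.
Proof.
by move=> /comp_run/(_ [::] [::]) /=; rewrite cats0; apply: halts_of_run.
Qed.

Definition lruns p T h t T' h' := exists2 t', t' <= t & lexec p T h t' T' h'.

Lemma lruns_leq p T h t t' T' h' : t <= t' -> lruns p T h t T' h' -> lruns p T h t' T' h'.
Proof. by move=> tt' [u ut H]; exists u => //; apply: leq_trans tt'. Qed.

Lemma lruns_seq p q T h t T1 h1 t1 T2 h2 u :
  lruns p T h t T1 h1 -> lruns q T1 h1 t1 T2 h2 -> t + t1 <= u ->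
  lruns (LSeq p q) T h u T2 h2.
Proof.
move=> [a ha Ha] [b hb Hb] Hu; exists (a + b); first by lia.
exact: lexec_seq Ha Hb.
Qed.

Lemma lruns_if (f : option bool -> bool) p q T h t T1 h1 u :
  lruns (if f (T h) then p else q) T h t T1 h1 -> t + 2 <= u ->
  lruns (LIf f p q) T h u T1 h1.
Proof.
case E: (f (T h)) => -[a ha Ha] Hu.
- by exists (a + 2); [lia | apply: lexec_ift].
- by exists (a + 1); [lia | apply: lexec_iff; rewrite ?E].
Qed.

Lemma lruns_whilef (f : option bool -> bool) p T h t :
  ~~ f (T h) -> 0 < t -> lruns (LWhile f p) T h t T h.
Proof. by move=> fT t0; exists 1 => //; apply: lexec_whilef. Qed.

Lemma lruns_whilet (f : option bool -> bool) p T h t T1 h1 t1 T2 h2 u :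
  f (T h) -> lruns p T h t T1 h1 -> lruns (LWhile f p) T1 h1 t1 T2 h2 ->
  t + t1 + 2 <= u -> lruns (LWhile f p) T h u T2 h2.
Proof.
move=> fT [a ha Ha] [b hb Hb] Hu; exists (a + b + 2); first by lia.
exact: lexec_whilet Ha Hb.
Qed.

Definition lmoves d n := iter n (LSeq (LMove d)) LSkip.

Lemma lruns_movesL n T h : lruns (lmoves MoveL n) T h n T (h - Z.of_nat n)%Z.
Proof.
elim: n h => [|n IH] h; first by exists 0 => //; rewrite Z.sub_0_r; constructor.
apply: (@lruns_seq _ _ _ _ 1 T (h - 1)%Z n); last by lia.
  by exists 1 => //; constructor.
have -> : (h - Z.of_nat n.+1 = h - 1 - Z.of_nat n)%Z by lia.
exact: IH.
Qed.

Lemma lruns_movesR n T h : lruns (lmoves MoveR n) T h n T (h + Z.of_nat n)%Z.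
Proof.
elim: n h => [|n IH] h; first by exists 0 => //; rewrite Z.add_0_r; constructor.
apply: (@lruns_seq _ _ _ _ 1 T (h + 1)%Z n); last by lia.
  by exists 1 => //; constructor.
have -> : (h + Z.of_nat n.+1 = h + 1 + Z.of_nat n)%Z by lia.
exact: IH.
Qed.

Lemma lruns_write w T h t : 0 < t -> lruns (LWrite w) T h t (twrite T h w) h.
Proof. by exists 1 => //; constructor. Qed.

(** * Stacks interleaved on one tape *)

(* Lane [i] of the tape holds stack [i], bottom first; depth 0 is an always blank
   sentinel.  Lane 0 runs to the right through the cells 0, 1, 2, ..., where the
   input and the output live; lanes 1 to 16 interleave on the negative cells. *)
Definition addr (i d : nat) : Z :=
  if i is 0 then (Z.of_nat d - 1)%Z else (- Z.of_nat i - 16 * Z.of_nat d)%Z.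

Definition cell (l : seq bool) (d : nat) : option bool :=
  if d is d'.+1 then nth None (map Some (rev l)) d' else None.

Definition lane (T : tape) (i : nat) (l : seq bool) : Prop :=
  forall d, T (addr i d) = cell l d.

(** One of the depths has to be positive: lanes 0 and 1 share the cell -1 as their sentinel. This is
    harmless because sentinels are never written. *)
Lemma addr_inj i j d e : i <= 16 -> j <= 16 -> addr i d.+1 = addr j e ->
  i = j /\ d.+1 = e.
Proof. by case: i => [|i]; case: j => [|j]; rewrite /addr; lia. Qed.

Lemma isSome_cell l d : isSome (cell l d) = (0 < d <= size l).
Proof.
case: d => [|d] //=.
case: (ltnP d (size l)) => h; first by rewrite (nth_map true) ?size_rev.
by rewrite nth_default ?size_map ?size_rev.
Qed.

Lemma cell_cons b l d :
  cell (b :: l) d = if d == (size l).+1 then Some b else cell l d.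
Proof.
case: d => [|d] //=; rewrite eqSS rev_cons map_rcons nth_rcons size_map size_rev.
case: ltngtP => // h; by rewrite nth_default ?size_map ?size_rev // ltnW.
Qed.

Lemma lane_push T i l b : i <= 16 -> lane T i l ->
  lane (twrite T (addr i (size l).+1) (Some b)) i (b :: l).
Proof.
move=> i16 Hl d; rewrite /twrite cell_cons.
case: Z.eqb_spec => [/esym/addr_inj[] //|ne]; first by move=> _ ->; rewrite eqxx.
by case: eqP => [e|_]; [rewrite e in ne | rewrite Hl].
Qed.

Lemma lane_pop T i l b : i <= 16 -> lane T i (b :: l) ->
  lane (twrite T (addr i (size l).+1) None) i l.
Proof.
move=> i16 Hl d; rewrite /twrite.
case: Z.eqb_spec => [/esym/addr_inj[] //|ne].
  move=> _ <-; case E: (cell _ _) => [c|] //.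
  by have := isSome_cell l (size l).+1; rewrite E ltnn andbF.
by rewrite Hl cell_cons; case: eqP => // e; rewrite e in ne.
Qed.

Lemma lane_other T i j l d w : i <= 16 -> j <= 16 -> i != j -> lane T j l ->
  lane (twrite T (addr i d.+1) w) j l.
Proof.
move=> i16 j16 ij Hl e; rewrite /twrite Hl.
case: Z.eqb_spec => [/esym/addr_inj[] //|//].
by move=> eij; rewrite eij eqxx in ij.
Qed.

(** Between operations the head rests at cell 0, from which [lenter] reaches the sentinel of the
    lane. [ldown] increases the depth, so it moves towards the top of the stack. *)
Definition lenter i := if i is 0 then LMove MoveL else lmoves MoveL i.
Definition lleave i := if i is 0 then LMove MoveR else lmoves MoveR i.
Definition ldown i := if i is 0 then LMove MoveR else lmoves MoveL 16.
Definition lup i := if i is 0 then LMove MoveL else lmoves MoveR 16.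

Lemma lruns_move d T h h' t : h' = dmove d h -> 0 < t -> lruns (LMove d) T h t T h'.
Proof. by move=> -> t0; exists 1 => //; constructor. Qed.

Lemma lruns_enter i T : i <= 16 -> lruns (lenter i) T 0%Z 16 T (addr i 0).
Proof.
case: i => [|i] i16; first by apply: lruns_move.
have -> : addr i.+1 0 = (0 - Z.of_nat i.+1)%Z by rewrite /addr; lia.
exact: lruns_leq i16 (lruns_movesL _ _ _).
Qed.

Lemma lruns_leave i T : i <= 16 -> lruns (lleave i) T (addr i 0) 16 T 0%Z.
Proof.
case: i => [|i] i16; first by apply: lruns_move.
have E : (0 = addr i.+1 0 + Z.of_nat i.+1)%Z by rewrite /addr; lia.
apply: lruns_leq i16 _; move: (lruns_movesR i.+1 T (addr i.+1 0)); rewrite -E; apply.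
Qed.

Lemma lruns_down i T d : lruns (ldown i) T (addr i d) 16 T (addr i d.+1).
Proof.
case: i => [|i]; first by apply: lruns_move => //; rewrite /addr /dmove; lia.
have -> : addr i.+1 d.+1 = (addr i.+1 d - Z.of_nat 16)%Z by rewrite /addr; lia.
exact: lruns_movesL.
Qed.

Lemma lruns_up i T d : lruns (lup i) T (addr i d.+1) 16 T (addr i d).
Proof.
case: i => [|i]; first by apply: lruns_move => //; rewrite /addr /dmove; lia.
have -> : addr i.+1 d = (addr i.+1 d.+1 + Z.of_nat 16)%Z by rewrite /addr; lia.
exact: lruns_movesR.
Qed.

(** Depth 1 is where emptiness can be tested without a scan: that cell is blank exactly when the
    stack is empty. *)
Definition lbottom i := LSeq (lenter i) (ldown i).
Definition lunbottom i := LSeq (lup i) (lleave i).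
Definition ltop i := LSeq (lbottom i) (LWhile isSome (ldown i)).
Definition lhome i := LSeq (LSeq (lup i) (LWhile isSome (lup i))) (lleave i).

Lemma lruns_bottom i T t : i <= 16 -> 32 <= t -> lruns (lbottom i) T 0%Z t T (addr i 1).
Proof. by move=> i16 ht; apply: lruns_seq (lruns_enter _ i16) (lruns_down _ _ _) _. Qed.

Lemma lruns_unbottom i T t : i <= 16 -> 32 <= t -> lruns (lunbottom i) T (addr i 1) t T 0%Z.
Proof. by move=> i16 ht; apply: lruns_seq (lruns_up _ _ _) (lruns_leave _ i16) _. Qed.

(** 32 steps lead to depth 1, each symbol costs a move of at most 16 steps and two jumps, and the
    last test costs 1. *)
Lemma lruns_top i T l : i <= 16 -> lane T i l ->
  lruns (ltop i) T 0%Z (33 + 18 * size l) T (addr i (size l).+1).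
Proof.
move=> i16 Hl; apply: (@lruns_seq _ _ _ _ 32 T (addr i 1) (18 * size l + 1)); last by lia.
  exact: lruns_bottom.
suff H k d : d.+1 + k = (size l).+1 ->
    lruns (LWhile isSome (ldown i)) T (addr i d.+1) (18 * k + 1) T (addr i (size l).+1).
  exact: (H (size l) 0).
elim: k d => [|k IH] d.
  rewrite addn0 => ->; apply: lruns_whilef; last by lia.
  by rewrite Hl isSome_cell ltnn andbF.
move=> dk; apply: (lruns_whilet _ (lruns_down _ _ _)).
- by rewrite Hl isSome_cell; lia.
- by apply: IH; lia.
- by lia.
Qed.

(** The bound on d admits both uses: after a push the head is on the new top, after a pop on the
    blank just above the stack. For the latter, [lhome] makes its first [lup] before any test. *)
Lemma lruns_home i T l d : i <= 16 -> lane T i l -> d <= size l ->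
  lruns (lhome i) T (addr i d.+1) (33 + 18 * d) T 0%Z.
Proof.
move=> i16 Hl dl.
apply: (@lruns_seq _ _ _ _ (17 + 18 * d) T (addr i 0) 16); last by lia.
  apply: (@lruns_seq _ _ _ _ 16 T (addr i d) (1 + 18 * d)); last by lia.
    exact: lruns_up.
  elim: d dl => [|d IH] dl.
    by apply: lruns_whilef; rewrite ?Hl ?isSome_cell; lia.
  apply: (lruns_whilet _ (lruns_up _ _ _)).
  - by rewrite Hl isSome_cell; lia.
  - by apply: IH; lia.
  - by lia.
exact: lruns_leave.
Qed.

(** * Stack programs and their compilation *)

Inductive hprog :=
  | HSkip
  | HSeq of hprog & hprog
  | HPush of nat & bool
  | HCase of nat & hprog & hprog & hprog
  | HLoop of nat & hprog & hprog.

Definition store := seq (seq bool).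
Notation get s i := (nth [::] s i).
Notation put s i l := (set_nth [::] s i l).

(* [HCase i] and [HLoop i] pop stack [i] before running a branch; the time [t]
   counts pushes, pops and emptiness tests. *)
Inductive hexec : hprog -> store -> nat -> store -> Prop :=
  | hexec_skip s : hexec HSkip s 0 s
  | hexec_seq p q s t s1 t1 s2 :
      hexec p s t s1 -> hexec q s1 t1 s2 -> hexec (HSeq p q) s (t + t1) s2
  | hexec_push i b s : hexec (HPush i b) s 1 (put s i (b :: get s i))
  | hexec_case_nil i pe pf pt s t s1 :
      get s i = [::] -> hexec pe s t s1 -> hexec (HCase i pe pf pt) s t.+1 s1
  | hexec_case_cons i pe pf pt s t s1 (b : bool) l :
      get s i = b :: l -> hexec (if b then pt else pf) (put s i l) t s1 ->
      hexec (HCase i pe pf pt) s t.+1 s1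
  | hexec_loop_nil i pf pt s : get s i = [::] -> hexec (HLoop i pf pt) s 1 s
  | hexec_loop_cons i pf pt s t s1 t1 s2 (b : bool) l :
      get s i = b :: l -> hexec (if b then pt else pf) (put s i l) t s1 ->
      hexec (HLoop i pf pt) s1 t1 s2 -> hexec (HLoop i pf pt) s (t + t1).+1 s2.

Fixpoint hwf (p : hprog) : bool :=
  match p with
  | HSkip => true
  | HSeq p q => hwf p && hwf q
  | HPush i _ => i <= 16
  | HCase i p q r => [&& i <= 16, hwf p, hwf q & hwf r]
  | HLoop i p q => [&& i <= 16, hwf p & hwf q]
  end.

(** One [lup] from the blank above the stack leads to the top symbol or, if the stack is empty, to
    the blank sentinel; the outer test tells these apart. *)
Definition lcase i pe pf pt :=
  LSeq (ltop i) (LSeq (lup i)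
    (LIf isSome
       (LIf (fun c => c == Some true)
          (LSeq (LWrite None) (LSeq (lhome i) pt))
          (LSeq (LWrite None) (LSeq (lhome i) pf)))
       (LSeq (lleave i) pe))).

(** The test is made at depth 1; the head then goes home and [lcase] does the popping. Its empty
    branch is never taken. *)
Definition lloop i pf pt :=
  LWhile isSome (LSeq (lunbottom i) (LSeq (lcase i LSkip pf pt) (lbottom i))).

Fixpoint hcomp (p : hprog) : lprog :=
  match p with
  | HSkip => LSkip
  | HSeq p q => LSeq (hcomp p) (hcomp q)
  | HPush i b => LSeq (ltop i) (LSeq (LWrite (Some b)) (lhome i))
  | HCase i p q r => lcase i (hcomp p) (hcomp q) (hcomp r)
  | HLoop i p q => LSeq (lbottom i) (LSeq (lloop i (hcomp p) (hcomp q)) (lunbottom i))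
  end.

Definition rep (s : store) (T : tape) := forall i, i <= 16 -> lane T i (get s i).
Definition bounded (s : store) (B : nat) := forall i, size (get s i) <= B.

Lemma bounded_put s i l B : bounded s B -> size l <= B -> bounded (put s i l) B.
Proof. by move=> Hs Hl j; rewrite nth_set_nth /=; case: eqP. Qed.

(** Only a push lengthens a stack, by one bit per unit of time; hence the running time also bounds
    the distances that the head has to travel. *)
Lemma hexec_bounded p s t s' B : hexec p s t s' -> bounded s B -> bounded s' (B + t).
Proof.
move=> H; elim: H B => {p s t s'}.
- by move=> s B; rewrite addn0.
- by move=> p q s t s1 t1 s2 _ IHp _ IHq B /IHp/IHq; rewrite addnA.
- move=> i b s B Hs; apply: bounded_put => [j|]; first by apply: leq_trans (leq_addr _ _).
  by rewrite addn1 /= ltnS.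
- by move=> i pe pf pt s t s1 _ _ IH B /IH H j; apply: leq_trans (H j) _; lia.
- move=> i pe pf pt s t s1 b l E _ IH B Hs j.
  have Hl : size l <= B by have := Hs i; rewrite E /=; lia.
  by apply: leq_trans (IH B (bounded_put _ Hs Hl) j) _; lia.
- by move=> i pf pt s _ B Hs j; apply: leq_trans (Hs j) _; lia.
- move=> i pf pt s t s1 t1 s2 b l E _ IH _ IHl B Hs j.
  have Hl : size l <= B by have := Hs i; rewrite E /=; lia.
  by apply: leq_trans (IHl _ (IH B (bounded_put _ Hs Hl)) j) _; lia.
Qed.

Lemma rep_push s T i b : i <= 16 -> rep s T ->
  rep (put s i (b :: get s i)) (twrite T (addr i (size (get s i)).+1) (Some b)).
Proof.
move=> i16 Hs j j16; rewrite nth_set_nth /=; case: eqVneq => [->|ji].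
  by apply: lane_push => //; apply: Hs.
by apply: lane_other; rewrite 1?eq_sym //; apply: Hs.
Qed.

Lemma rep_pop s T i b l : i <= 16 -> rep s T -> get s i = b :: l ->
  rep (put s i l) (twrite T (addr i (size l).+1) None).
Proof.
move=> i16 Hs E j j16; rewrite nth_set_nth /=; case: eqVneq => [->|ji].
  by apply: (lane_pop (b := b)) => //; rewrite -E; apply: Hs.
by apply: lane_other; rewrite 1?eq_sym //; apply: Hs.
Qed.

Lemma lruns_case_nil i pe pf pt s T t T1 u : i <= 16 -> rep s T -> get s i = [::] ->
  lruns pe T 0%Z t T1 0%Z -> t + 100 <= u -> lruns (lcase i pe pf pt) T 0%Z u T1 0%Z.
Proof.
move=> i16 Hs E Hp Hu; have := Hs i i16; rewrite E => Hl.
apply: (lruns_seq (lruns_top i16 Hl) (t1 := t + 60)); last by rewrite /=; lia.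
apply: (lruns_seq (lruns_up _ _ _) (t1 := t + 44)); last by lia.
apply: (lruns_if (t := t + 20)); last by lia.
rewrite Hl /=.
by apply: (lruns_seq (lruns_leave _ i16) Hp); lia.
Qed.

Lemma lruns_case_cons i pe pf pt s T t T1 u (b : bool) l B :
  i <= 16 -> rep s T -> get s i = b :: l -> size (get s i) <= B ->
  (let T0 := twrite T (addr i (size l).+1) None in
   rep (put s i l) T0 -> lruns (if b then pt else pf) T0 0%Z t T1 0%Z) ->
  t + 100 + 36 * B <= u -> lruns (lcase i pe pf pt) T 0%Z u T1 0%Z.
Proof.
move=> i16 Hs E; rewrite E /= => lB Hp Hu; have := Hs i i16; rewrite E => Hl.
have Hpop := rep_pop i16 Hs E.
have := Hpop i i16; rewrite nth_set_nth /= eqxx => Hl'.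
apply: (lruns_seq (lruns_top i16 Hl) (t1 := t + 60 + 18 * size l)); last by rewrite /=; lia.
apply: (lruns_seq (lruns_up _ _ _) (t1 := t + 44 + 18 * size l)); last by lia.
apply: (lruns_if (t := t + 40 + 18 * size l)); last by lia.
have TE : T (addr i (size l).+1) = Some b by rewrite Hl cell_cons eqxx.
rewrite TE /=.
apply: (lruns_if (t := t + 38 + 18 * size l)); last by lia.
rewrite TE.
case: b {E Hl TE} Hp => Hp /=;
  apply: (lruns_seq (lruns_write _ _ _ (t := 1) _) (t1 := t + 37 + 18 * size l)) => //;
  try lia; apply: (lruns_seq (lruns_home i16 Hl' (leqnn _)) (Hp Hpop)); lia.
Qed.

(* Loops are compiled to [LWhile] between two moves of the head; the invariant is
   about the [LWhile] alone, so that it can be unrolled. *)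
Definition hcore (p : hprog) : lprog :=
  if p is HLoop i pf pt then lloop i (hcomp pf) (hcomp pt) else hcomp p.
Definition hstart (p : hprog) : Z := if p is HLoop i _ _ then addr i 1 else 0%Z.

(** 32 steps for [lbottom] and 32 for [lunbottom], which surround the core of a loop. *)
Definition hslack (p : hprog) : nat := if p is HLoop _ _ _ then 64 else 0.

Lemma lruns_hcore p T t T' u : hwf p ->
  lruns (hcore p) T (hstart p) t T' (hstart p) -> t + hslack p <= u ->
  lruns (hcomp p) T 0%Z u T' 0%Z.
Proof.
case: p => [|p q|i b|i pe pf pt|i pf pt] /=; try by move=> _ H Hu; apply: lruns_leq H; lia.
case/and3P=> i16 _ _ H Hu.
apply: (lruns_seq (lruns_bottom _ i16 (leqnn _)) (t1 := t + 32)); last by lia.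
by apply: (lruns_seq H (lruns_unbottom _ i16 (leqnn _))).
Qed.

(** All stacks stay within N during the run, so one operation costs at most a multiple of [N.+1]. N
    is fixed throughout the induction while B grows along the run. The factor 300 is generous enough
    to absorb the slack of loops. *)
Lemma hcore_run p s t s' : hexec p s t s' -> hwf p ->
  forall T B N, rep s T -> bounded s B -> B + t <= N ->
  exists2 T', rep s' T' & exists2 u,
    lruns (hcore p) T (hstart p) u T' (hstart p) & u + hslack p <= 300 * N.+1 * t.
Proof.
have branch (b : bool) pf pt : hwf pf -> hwf pt -> hwf (if b then pt else pf).
  by case: b.
elim=> {p s t s'}.
- move=> s _ T B N Hs _ _; exists T => //; exists 0; last by rewrite muln0.
  by exists 0 => //; constructor.
- move=> p q s t s1 t1 s2 Ep IHp Eq IHq /andP[wp wq] T B N Hs HB HN.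
  have [|||T1 H1 [u1 R1 U1]] := IHp wp T B N => //; first by lia.
  have [|||T2 H2 [u2 R2 U2]] := IHq wq T1 (B + t) N => //; first exact: hexec_bounded Ep HB.
    by lia.
  exists T2 => //; exists (300 * N.+1 * (t + t1)); last by rewrite addn0.
  apply: (lruns_seq (lruns_hcore wp R1 U1) (lruns_hcore wq R2 U2)).
  by rewrite mulnDr.
- move=> i b s /= i16 T B N Hs HB HN; eexists; first exact: rep_push i16 Hs.
  exists (100 + 36 * B); last by rewrite /=; lia.
  have Hi := HB i.
  apply: (lruns_seq (lruns_top i16 (Hs i i16)) (t1 := 60 + 18 * B)); last by lia.
  have Hl := lane_push b i16 (Hs i i16).
  have Hh := lruns_home (d := size (get s i)) i16 Hl (leqnSn _).
  by apply: (lruns_seq (lruns_write _ _ _ (t := 1) _) Hh) => //; lia.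
- move=> i pe pf pt s t s1 E _ IH /and4P[i16 we _ _] T B N Hs HB HN.
  have [|||T1 H1 [u1 R1 U1]] := IH we T B N => //; first by lia.
  exists T1 => //; exists (300 * N.+1 * t.+1); last by rewrite addn0.
  apply: (lruns_case_nil _ _ i16 Hs E (lruns_hcore we R1 U1)); lia.
- move=> i pe pf pt s t s1 b l E _ IH /and4P[i16 _ wf wt] T B N Hs HB HN.
  have Hi := HB i.
  have Hl : bounded (put s i l) B by apply: bounded_put => //; rewrite E /= in Hi; lia.
  have [||T1 H1 [u1 R1 U1]] := IH (branch _ _ _ wf wt) _ B N (rep_pop i16 Hs E) => //.
    by lia.
  exists T1 => //; exists (300 * N.+1 * t.+1); last by rewrite addn0.
  have := lruns_hcore (branch _ _ _ wf wt) R1 U1; rewrite (fun_if hcomp) => R.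
  apply: (lruns_case_cons _ i16 Hs E Hi (fun _ => R)).
  by lia.
- move=> i pf pt s E /and3P[i16 _ _] T B N Hs HB HN; exists T => //; exists 1 => /=; last by lia.
  apply: lruns_whilef => //; by rewrite Hs // isSome_cell E.
- move=> i pf pt s t s1 t1 s2 b l E Eb IH El IHl /= w T B N Hs HB HN.
  have /and3P[i16 wf wt] := w.
  have Hi := HB i.
  have Hl : bounded (put s i l) B by apply: bounded_put => //; rewrite E /= in Hi; lia.
  have [||T1 H1 [u1 R1 U1]] := IH (branch _ _ _ wf wt) _ B N (rep_pop i16 Hs E) => //.
    by lia.
  have [|||T2 H2 [u2 R2 U2]] := IHl w T1 (B + t) N => //; first exact: hexec_bounded Eb Hl.
    by lia.
  (* The 64 steps subtracted here are the slack that [hcomp] spends once around the whole loop. *)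
  exists T2 => //; exists (300 * N.+1 * (t + t1).+1 - 64); last by rewrite /=; lia.
  have := lruns_hcore (branch _ _ _ wf wt) R1 U1; rewrite (fun_if hcomp) => R.
  have Hc := lruns_case_cons LSkip i16 Hs E Hi (fun _ => R) (leqnn _).
  rewrite /= in U2.
  apply: (lruns_whilet _ (lruns_seq (lruns_unbottom _ i16 (leqnn _))
    (lruns_seq Hc (lruns_bottom _ i16 (leqnn _)) (leqnn _)) (leqnn _)) R2).
    by rewrite Hs // isSome_cell E.
  by lia.
Qed.

Lemma hcomp_run p s t s' T B : hexec p s t s' -> hwf p -> rep s T -> bounded s B ->
  exists2 T', rep s' T' & lruns (hcomp p) T 0%Z (300 * (B + t).+1 * t) T' 0%Z.
Proof.
move=> E w Hs HB.
have [T' HT [u R U]] := hcore_run E w Hs HB (leqnn _).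
by exists T' => //; apply: lruns_hcore U.
Qed.

(** Stack 0 lies on the cells 0, 1, 2, ... with its bottom at the left, so a word on the tape is the
    reversal of the stack; all other stacks start empty by the default of [nth]. *)
Lemma hprog_halts p w out t s' : hwf p -> hexec p [:: rev w] t s' ->
  get s' 0 = rev out ->
  halts_within (tm_of (comp (hcomp p) 0)) w (300 * (size w + t).+1 * t) out.
Proof.
move=> wfp E Eout.
have HB : bounded [:: rev w] (size w).
  by move=> [|i] /=; rewrite ?size_rev // nth_nil.
have Hs : rep [:: rev w] (init_tape w).
  move=> [|i] i16 d.
    case: d => [|d] //; rewrite /init_tape /addr /cell revK.
    case: Z.ltb_spec => [?|_]; first by lia.
    by have -> : Z.to_nat (Z.of_nat d.+1 - 1) = d by lia.
  have -> : get [:: rev w] i.+1 = [::] by rewrite /= nth_nil.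
  rewrite /init_tape /addr; case: Z.ltb_spec => [_|?]; last by lia.
  by case: d => //= d; rewrite nth_nil.
have [T' HT [u u_le R]] := hcomp_run E wfp Hs HB.
have [|t' [Ht' H]] := lprog_halts R (out := out).
  move=> i; have := HT 0 isT i.+1; rewrite Eout /cell revK => <-.
  by apply: (congr1 T'); rewrite /addr; lia.
by exists t'; split=> //; apply: leq_trans u_le.
Qed.

(** * Polynomial bounds *)

Definition poly_bounded (f : nat -> nat) := exists c d, forall n, f n <= c * n.+1 ^ d.

Lemma poly_bounded_const c : poly_bounded (fun=> c).
Proof. by exists c, 0 => n; rewrite muln1. Qed.

Lemma poly_bounded_id : poly_bounded id.
Proof. by exists 1, 1 => n; rewrite mul1n expn1. Qed.

Lemma poly_bounded_add f g : poly_bounded f -> poly_bounded g ->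
  poly_bounded (fun n => f n + g n).
Proof.
move=> [c [d H]] [c' [d' H']]; exists (c + c'), (d + d') => n.
rewrite mulnDl leq_add //; [apply: leq_trans (H n) _ | apply: leq_trans (H' n) _];
  by rewrite leq_mul2l leq_pexp2l ?orbT // ?leq_addr ?leq_addl.
Qed.

Lemma poly_bounded_mul f g : poly_bounded f -> poly_bounded g ->
  poly_bounded (fun n => f n * g n).
Proof.
move=> [c [d H]] [c' [d' H']]; exists (c * c'), (d + d') => n.
by rewrite expnD mulnACA leq_mul.
Qed.

Lemma poly_time_hprog (A B : Type) (encA : A -> seq bool) (encB : B -> seq bool)
    (P : A -> Prop) (f : A -> B) (p : hprog) (time : nat -> nat) :
  hwf p -> poly_bounded time ->
  (forall a, P a -> exists t s', [/\ hexec p [:: rev (encA a)] t s',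
     t <= time (size (encA a)) & get s' 0 = rev (encB (f a))]) ->
  poly_time encA encB P f.
Proof.
move=> wfp pt H.
have [c [d Hcd]] : poly_bounded (fun n => 300 * (n + time n + 1) * time n).
  do ![apply: poly_bounded_mul => // | apply: poly_bounded_add => //
      | exact: poly_bounded_id | exact: poly_bounded_const].
exists (tm_of (comp (hcomp p) 0)), c, d => a /H[t [s' [E Ht Es]]].
have [t' [Ht' Hh]] := hprog_halts wfp E Es.
exists t'; split=> //; apply: leq_trans (Hcd _); apply: leq_trans Ht' _.
by apply: leq_mul => //; rewrite leq_mul2l /=; lia.
Qed.

(** * The reduction *)

Lemma big_ord_mul (R : Type) (idx : R) (op : Monoid.com_law idx) (m n : nat) (F : nat -> R) :
  \big[op/idx]_(g < m * n) F g =
  \big[op/idx]_(j < m) \big[op/idx]_(i < n) F (j * n + i).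
Proof.
elim: m => [|m IH]; first by rewrite mul0n !big_ord0.
rewrite big_ord_recr /= -IH -!(big_mkord xpredT) -(big_mkord xpredT (fun i => F (m * n + i))).
rewrite mulSn addnC (big_cat_nat (n := m * n)) ?leq_addr //=; congr (op _ _).
rewrite -{1}[m * n]add0n big_addn addKn.
by apply: eq_bigr => i _; rewrite addnC.
Qed.

(* Public good [j * n + i] stands for giving private good [j] to agent [i]. *)
Definition agent_row (n m i : nat) (r : seq nat) : seq nat :=
  mkseq (fun g => if g %% n == i then nth 0 r (g %/ n) else 0) (m * n).
Definition good_row (n m j : nat) : seq nat :=
  mkseq (fun g => nat_of_bool (g %/ n == j)) (m * n).

(** Added agent [c * m + j] is the c-th one of private good j. With this numbering the added rows
    are n + 1 repetitions of one block of m rows, which a loop can emit. *)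
Definition reduction (I : priv_inst) : pub_inst :=
  let n := pr_n I in let m := pr_m I in
  PubInst (n + n.+1 * m) (m * n) m
    (mkseq (fun i => agent_row n m i (nth [::] (pr_v I) i)) n ++
     mkseq (fun a => good_row n m (a %% m)) (n.+1 * m)).

Definition copies (n : nat) (x : seq bool) (j : nat) : nat :=
  \sum_(i < n) nth false x (j * n + i).
(** If exactly one copy of j is chosen, the sum has a single term with factor 1 and equals the index
    of that copy. A program can accumulate it while reading x once. *)
Definition owner (n : nat) (x : seq bool) (j : nat) : nat :=
  \sum_(i < n) nth false x (j * n + i) * i.
Definition owners (I : priv_inst) (x : seq bool) : seq nat :=
  mkseq (owner (pr_n I) x) (pr_m I).

Definition alloc_goods (I : priv_inst) (a : seq nat) : seq bool :=
  mkseq (fun g => g %% pr_n I == nth 0 a (g %/ pr_n I)) (pr_m I * pr_n I).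

Section Reduction.

Variable I : priv_inst.
Notation n := (pr_n I).
Notation m := (pr_m I).
Hypothesis n_gt0 : 0 < n.

Implicit Types (x : seq bool) (a : seq nat).

Lemma block_lt i j : i < n -> j < m -> j * n + i < m * n.
Proof.
move=> ltin ltjm; apply: (@leq_trans (j.+1 * n)).
  by rewrite mulSn addnC ltn_add2r.
by rewrite leq_mul2r ltjm orbT.
Qed.

Lemma block_divn i j : i < n -> (j * n + i) %/ n = j.
Proof. by move=> ltin; rewrite divnMDl // divn_small // addn0. Qed.

Lemma block_modn i j : i < n -> (j * n + i) %% n = i.
Proof. by move=> ltin; rewrite modnMDl modn_small. Qed.

Lemma pub_utilE x (a : nat) : pub_util (reduction I) x a =
  \sum_(j < m) \sum_(i < n)
    nth false x (j * n + i) * Defs.val (pu_v (reduction I)) a (j * n + i).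
Proof.
rewrite /pub_util /= big_mkcond /=.
rewrite -(big_ord_mul _ m n
  (fun g => nth false x g * Defs.val (pu_v (reduction I)) a g)).
by apply: eq_bigr => g _; case: nth; rewrite ?mul1n ?mul0n.
Qed.

Lemma pub_util_agent x (i : 'I_n) : pub_util (reduction I) x i =
  \sum_(j < m) nth false x (j * n + i) * Defs.val (pr_v I) i j.
Proof.
rewrite pub_utilE; apply: eq_bigr => j _.
rewrite (bigD1 i) //= big1 ?addn0 => [|k ki].
  rewrite /Defs.val nth_cat size_mkseq ltn_ord nth_mkseq // nth_mkseq ?block_lt //.
  by rewrite block_divn // block_modn // eqxx.
rewrite /Defs.val nth_cat size_mkseq ltn_ord nth_mkseq // nth_mkseq ?block_lt //.
by rewrite block_modn // (negPf ki : (k == i :> nat) = false) muln0.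
Qed.

Lemma pub_util_good x (c : 'I_n.+1) (j : 'I_m) :
  pub_util (reduction I) x (n + (c * m + j)) = copies n x j.
Proof.
have lt_cj : c * m + j < n.+1 * m.
  apply: (@leq_trans (c.+1 * m)); first by rewrite mulSn addnC ltn_add2r.
  by rewrite leq_mul2r ltn_ord orbT.
rewrite pub_utilE (bigD1 j) //= [X in _ + X]big1 ?addn0 => [|k kj].
  apply: eq_bigr => i _.
  rewrite /Defs.val nth_cat size_mkseq ltnNge leq_addr /= addKn nth_mkseq //.
  rewrite nth_mkseq ?block_lt // block_divn // modnMDl modn_small // eqxx.
  by rewrite muln1.
apply: big1 => i _.
rewrite /Defs.val nth_cat size_mkseq ltnNge leq_addr /= addKn nth_mkseq //.
rewrite nth_mkseq ?block_lt // block_divn // modnMDl modn_small //.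
by rewrite (negPf kj : (k == j :> nat) = false) muln0.
Qed.

(** The generality in [op] and [F] lets one splitting serve the product, the number of positive
    utilities and the product of the positive ones. *)
Lemma big_pub (T : Type) (idx : T) (op : Monoid.com_law idx) (F : nat -> T) x :
  \big[op/idx]_(b < n + n.+1 * m) F (pub_util (reduction I) x b) =
  op (\big[op/idx]_(i < n) F (pub_util (reduction I) x i))
     (\big[op/idx]_(c < n.+1) \big[op/idx]_(j < m) F (copies n x j)).
Proof.
rewrite big_split_ord /=; congr (op _ _).
rewrite (big_ord_mul op n.+1 m (fun b => F (pub_util (reduction I) x (n + b)))).
by apply: eq_bigr => c _; apply: eq_bigr => j _; rewrite pub_util_good.
Qed.

Lemma nposE (A : Type) (N : nat) (u : A -> nat -> nat) y :
  npos N u y = \sum_(i < N) (0 < u y i).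
Proof. by rewrite /npos -sum1dep_card big_mkcond /=; apply: eq_bigr => i _; case: ltnP. Qed.

Lemma prodpos_mkcond (A : Type) (N : nat) (u : A -> nat -> nat) y :
  prodpos N u y = \prod_(i < N) (if 0 < u y i then u y i else 1).
Proof. exact: big_mkcond. Qed.

Lemma sum_copies x : size x = m * n -> \sum_(j < m) copies n x j = count id x.
Proof.
move=> sx; rewrite -(big_ord_mul _ m n (fun g => nat_of_bool (nth false x g))) -sx.
by rewrite -sum1_count (big_nth false) big_mkord [RHS]big_mkcond; apply: eq_bigr => i _; case: nth.
Qed.

Definition covers x := forall j, j < m -> copies n x j = 1.

(** Pigeonhole: m summands, each at least 1, have a total of at most the budget m. *)
Lemma covers_of_pos x : pub_feasible (reduction I) x ->
  (forall j, j < m -> 0 < copies n x j) -> covers x.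
Proof.
move=> [/= sx cx] pos j ltjm; rewrite -sum_copies // in cx.
apply/eqP; rewrite eqn_leq pos // andbT leqNgt; apply/negP => big.
have : m < \sum_(j < m) copies n x j.
  rewrite -{1}[m]card_ord -sum1_card (bigD1 (Ordinal ltjm)) //=.
  rewrite [X in _ < X](bigD1 (Ordinal ltjm)) //= -addSn leq_add //.
  by apply: leq_sum => k _; apply: pos.
by rewrite ltnNge cx.
Qed.

Lemma coversP x j : covers x -> j < m ->
  owner n x j < n /\ forall i, i < n -> nth false x (j * n + i) = (i == owner n x j).
Proof.
move=> cov ltjm; have := cov j ltjm; rewrite /copies => E.
have /existsP[i0 xi0] : [exists i : 'I_n, nth false x (j * n + i)].
  apply: contraT; rewrite negb_exists => /forallP no.
  by move: E; rewrite big1 // => i _; rewrite (negPf (no i)).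
have no (i : 'I_n) : i != i0 -> nth false x (j * n + i) = false.
  move: E; rewrite (bigD1 i0) //= xi0 => -[/eqP]; rewrite sum_nat_eq0.
  by move=> /forallP/(_ i)/implyP H /H; rewrite eqb0 => /negPf.
have -> : owner n x j = i0.
  by rewrite /owner (bigD1 i0) //= xi0 mul1n big1 ?addn0 // => i /no ->.
split=> // i ltin; case: eqVneq => [->|ne]; first by rewrite xi0.
by rewrite -[i]/(nat_of_ord (Ordinal ltin)) no.
Qed.

Lemma covers_util x (i : 'I_n) : covers x ->
  pub_util (reduction I) x i = priv_util I (owners I x) i.
Proof.
move=> cov; rewrite pub_util_agent /priv_util [RHS]big_mkcond /=.
apply: eq_bigr => j _; rewrite (coversP cov _).2 // nth_mkseq // eq_sym.
by case: eqP; rewrite ?mul1n ?mul0n.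
Qed.

Lemma covers_feasible x : covers x -> priv_feasible I (owners I x).
Proof.
move=> cov; split; first by rewrite size_mkseq.
apply/allP => _ /mapP[j + ->]; rewrite mem_iota => /= ltjm.
by case: (coversP cov ltjm).
Qed.

Lemma alloc_copies a : priv_feasible I a -> covers (alloc_goods I a).
Proof.
move=> [sa alla] j ltjm; rewrite /copies.
have lta : nth 0 a j < n by apply: (allP alla); rewrite mem_nth ?sa.
rewrite (bigD1 (Ordinal lta)) //= big1 ?addn0 => [|i /negPf ne].
  by rewrite nth_mkseq ?block_lt // block_modn // block_divn // eqxx.
by rewrite nth_mkseq ?block_lt // block_modn // block_divn // (ne : (i == nth 0 a j :> nat) = false).
Qed.

Lemma alloc_feasible a : priv_feasible I a ->
  pub_feasible (reduction I) (alloc_goods I a).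
Proof.
move=> Fa; split; first by rewrite size_mkseq.
rewrite -sum_copies ?size_mkseq //=.
apply: (@leq_trans (\sum_(j < m) 1)); last by rewrite sum_nat_const card_ord muln1.
by apply: leq_sum => j _; rewrite alloc_copies.
Qed.

Lemma alloc_util a (i : 'I_n) :
  pub_util (reduction I) (alloc_goods I a) i = priv_util I a i.
Proof.
rewrite pub_util_agent /priv_util [RHS]big_mkcond /=.
apply: eq_bigr => j _; rewrite nth_mkseq ?block_lt // block_modn // block_divn // eq_sym.
by case: eqP; rewrite ?mul1n ?mul0n.
Qed.

Section Transfer.

Variables (x : seq bool) (a : seq nat).
Hypothesis cov : covers x.
Hypothesis util_eq : forall i : 'I_n, pub_util (reduction I) x i = priv_util I a i.

(** The pair of x and a is kept abstract because the transfer is used in both directions: for a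
    cover with its [owners], and for a private allocation with its [alloc_goods]. *)
Lemma transfer_prodU :
  prodU (pu_n (reduction I)) (pub_util (reduction I)) x = prodU n (priv_util I) a.
Proof.
rewrite /prodU /= (big_pub _ id x) /= [X in _ * X]big1 ?muln1 => [|c _].
  exact: eq_bigr.
by apply: big1 => j _; apply: cov.
Qed.

Lemma transfer_npos :
  npos (pu_n (reduction I)) (pub_util (reduction I)) x =
  npos n (priv_util I) a + n.+1 * m.
Proof.
rewrite !nposE /= (big_pub _ (fun u => nat_of_bool (0 < u)) x) /=; congr (_ + _).
  by apply: eq_bigr => i _; rewrite util_eq.
transitivity (\sum_(c < n.+1) \sum_(j < m) 1).
  by apply: eq_bigr => c _; apply: eq_bigr => j _; rewrite cov.
by rewrite !sum_nat_const !card_ord muln1.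
Qed.

Lemma transfer_prodpos :
  prodpos (pu_n (reduction I)) (pub_util (reduction I)) x = prodpos n (priv_util I) a.
Proof.
rewrite !prodpos_mkcond /= (big_pub _ (fun u => if 0 < u then u else 1) x) /=.
rewrite [X in _ * X]big1 ?muln1 => [|c _].
  by apply: eq_bigr => i _; rewrite util_eq.
by apply: big1 => j _; rewrite cov.
Qed.

End Transfer.

Lemma prodU_pos_covers x : pub_feasible (reduction I) x ->
  0 < prodU (pu_n (reduction I)) (pub_util (reduction I)) x -> covers x.
Proof.
move=> Fx; rewrite /prodU /= (big_pub _ id x) /= muln_gt0 => /andP[_ pos].
apply: covers_of_pos => // j ltjm; move: pos.
rewrite big_ord_recl muln_gt0 (bigD1 (Ordinal ltjm)) //= muln_gt0.
by case/andP=> /andP[].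
Qed.

(** With a good uncovered, at most (n+1)(m-1) added agents and n original ones are positive, one
    fewer than (n+1)m. *)
Lemma npos_covers x : pub_feasible (reduction I) x ->
  n.+1 * m <= npos (pu_n (reduction I)) (pub_util (reduction I)) x -> covers x.
Proof.
move=> Fx; rewrite nposE /= (big_pub _ (fun u => nat_of_bool (0 < u)) x) /=.
rewrite sum_nat_const card_ord => H; apply: covers_of_pos => // j ltjm.
rewrite lt0n; apply/eqP => cj0.
have: \sum_(i < n) (0 < pub_util (reduction I) x i) <= n.
  apply: (@leq_trans (\sum_(i < n) 1)); last by rewrite sum_nat_const card_ord muln1.
  by apply: leq_sum => i _; case: ltnP.
have: (\sum_(k < m) (0 < copies n x k)).+1 <= m.
  have sum1 : \sum_(k < m) 1 = m by rewrite sum_nat_const card_ord muln1.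
  rewrite -[X in _ <= X]sum1 (bigD1 (Ordinal ltjm)) //= cj0 add0n [X in _ <= X](bigD1 (Ordinal ltjm)) //=.
  by rewrite add1n ltnS; apply: leq_sum => k _; case: ltnP.
move=> Bm An; move: (leq_mul (leqnn n.+1) Bm); rewrite mulnS => H'.
by move: (leq_trans H' H); rewrite leq_add2r ltnNge An.
Qed.

Lemma pub_MNW_covers x : pub_MNW (reduction I) x -> covers x.
Proof.
move=> [Fx [max1 max2]].
case: (posnP (prodU (pu_n (reduction I)) (pub_util (reduction I)) x)) => [x0|];
  last exact: prodU_pos_covers.
(* Any private allocation would do for the comparison; giving everything to agent 0 is one, as n >
   0. *)
have F0 : priv_feasible I (nseq m 0).
  by split; [rewrite size_nseq | rewrite all_nseq n_gt0 orbT].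
have [||le_npos _] := max2 _ (alloc_goods I (nseq m 0)) _.
- by move=> [y [Fy ypos]]; have := max1 (ex_intro _ y (conj Fy ypos)) y Fy; rewrite x0 leqNgt ypos.
- exact: alloc_feasible.
apply: npos_covers => //; apply: leq_trans le_npos.
by rewrite (transfer_npos (alloc_copies F0) (alloc_util (nseq m 0))) leq_addl.
Qed.

Lemma reduction_correct x : pub_MNW (reduction I) x -> priv_MNW I (owners I x).
Proof.
move=> Mx; have cov := pub_MNW_covers Mx; case: Mx => Fx [max1 max2].
have ux i := covers_util i cov.
split; first exact: covers_feasible.
split=> [[b [Fb bpos]] b' Fb' | nopos b Fb].
  rewrite -(transfer_prodU cov ux).
  rewrite -(transfer_prodU (alloc_copies Fb') (alloc_util b')).
  apply: max1; last exact: alloc_feasible.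
  exists (alloc_goods I b); split; first exact: alloc_feasible.
  by rewrite (transfer_prodU (alloc_copies Fb) (alloc_util b)).
(* The degenerate case passes to the public side: a positive public product makes y a cover, and its
   owners would then have a positive private product. *)
have nopub : ~ (exists y, pub_feasible (reduction I) y /\
    0 < prodU (pu_n (reduction I)) (pub_util (reduction I)) y).
  move=> [y [Fy ypos]]; apply: nopos; have covy := prodU_pos_covers Fy ypos.
  exists (owners I y); split; first exact: covers_feasible.
  by rewrite -(transfer_prodU covy (fun i => covers_util i covy)).
have := max2 nopub _ (alloc_feasible Fb).
rewrite (transfer_npos cov ux) (transfer_prodpos cov ux).
rewrite (transfer_npos (alloc_copies Fb) (alloc_util b)).
rewrite (transfer_prodpos (alloc_copies Fb) (alloc_util b)).
by rewrite leq_add2r => -[le1 le2]; split=> // e; apply: le2; rewrite e.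
Qed.

End Reduction.

Lemma reduction_wf I : priv_wf I -> pub_wf (reduction I).
Proof.
move=> [n0 _]; split; first by rewrite size_cat !size_mkseq.
split; last by rewrite leq_pmulr.
rewrite all_cat; apply/andP; split; apply/allP => _ /mapP[i _ ->]; by rewrite size_mkseq.
Qed.

(** * Programs over stacks *)

Definition runs p s s' t := exists2 t', t' <= t & hexec p s t' s'.

Lemma runs_leq p s s' t t' : t <= t' -> runs p s s' t -> runs p s s' t'.
Proof. by move=> tt' [u ut H]; exists u => //; apply: leq_trans tt'. Qed.

Lemma runs_skip s t : runs HSkip s s t.
Proof. by exists 0 => //; constructor. Qed.

Lemma runs_seq p q s s1 s2 t t1 u :
  runs p s s1 t -> runs q s1 s2 t1 -> t + t1 <= u -> runs (HSeq p q) s s2 u.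
Proof.
move=> [a ha Ha] [b hb Hb] Hu; exists (a + b); first by lia.
exact: hexec_seq Ha Hb.
Qed.

Lemma runs_push i b s t : 0 < t -> runs (HPush i b) s (put s i (b :: get s i)) t.
Proof. by exists 1 => //; constructor. Qed.

Lemma runs_case_nil i pe pf pt s s1 t u :
  get s i = [::] -> runs pe s s1 t -> t < u -> runs (HCase i pe pf pt) s s1 u.
Proof.
move=> E [a ha Ha] Hu; exists a.+1; first by lia.
exact: hexec_case_nil.
Qed.

Lemma runs_case_cons i pe pf pt s s1 t u (b : bool) l :
  get s i = b :: l -> runs (if b then pt else pf) (put s i l) s1 t -> t < u ->
  runs (HCase i pe pf pt) s s1 u.
Proof.
move=> E [a ha Ha] Hu; exists a.+1; first by lia.
exact: hexec_case_cons E Ha.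
Qed.

Lemma runs_loop_nil i pf pt s t : get s i = [::] -> 0 < t -> runs (HLoop i pf pt) s s t.
Proof. by exists 1 => //; apply: hexec_loop_nil. Qed.

Lemma runs_loop_cons i pf pt s s1 s2 t t1 u (b : bool) l :
  get s i = b :: l -> runs (if b then pt else pf) (put s i l) s1 t ->
  runs (HLoop i pf pt) s1 s2 t1 -> t + t1 < u -> runs (HLoop i pf pt) s s2 u.
Proof.
move=> E [a ha Ha] [b' hb Hb] Hu; exists (a + b').+1; first by lia.
exact: hexec_loop_cons E Ha Hb.
Qed.

Lemma runs_loop_un i pf pt s s1 s2 t t1 u a :
  get s i = nseq a.+1 true -> runs pt (put s i (nseq a true)) s1 t ->
  runs (HLoop i pf pt) s1 s2 t1 -> t + t1 < u -> runs (HLoop i pf pt) s s2 u.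
Proof. exact: runs_loop_cons. Qed.

Declare Scope hprog_scope.
Delimit Scope hprog_scope with hprog.
Bind Scope hprog_scope with hprog.
Notation "p ;; q" := (HSeq p q) (at level 60, right associativity) : hprog_scope.
Local Open Scope hprog_scope.

Definition hmove i t := HLoop i (HPush t true) (HPush t true).
Definition hclear i := HLoop i HSkip HSkip.
(** Draining the counter into t shows the loop index to the body: in round k of a, stack t holds k
    and stack i holds a - k - 1. Inner loops over t and i thus run as often as there are rounds
    before and after the present one. *)
Definition hfor i t body :=
  HLoop i (body ;; HPush t true) (body ;; HPush t true) ;; hmove t i.

(** [S] is a store with two holes, and the four equations say that stacks i and t are these holes;
    for a concrete store they hold by computation. *)
Lemma runs_move i t (S : seq bool -> seq bool -> store) a b u :
  (forall x y, get (S x y) i = x) -> (forall x y, get (S x y) t = y) ->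
  (forall x y z, put (S x y) i z = S z y) -> (forall x y z, put (S x y) t z = S x z) ->
  2 * a < u ->
  runs (hmove i t) (S (nseq a true) (nseq b true)) (S [::] (nseq (a + b) true)) u.
Proof.
move=> gi gt pi pt Hu; apply: runs_leq Hu _.
elim: a b => [|a IH] b; first by apply: runs_loop_nil; rewrite ?gi.
rewrite addSnnS.
apply: (runs_loop_cons (b := true) (l := nseq a true) (t := 1) _ _ (IH b.+1)).
- by rewrite gi.
- have := @runs_push t true (S (nseq a true) (nseq b true)) 1 isT.
  by rewrite gt pt pi.
- by lia.
Qed.

Lemma runs_clear i (S : seq bool -> store) x u :
  (forall x, get (S x) i = x) -> (forall x y, put (S x) i y = S y) ->
  size x < u -> runs (hclear i) (S x) (S [::]) u.
Proof.
move=> gi pi Hu; apply: runs_leq Hu _.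
elim: x => [|b x IH]; first by apply: runs_loop_nil; rewrite ?gi.
apply: (runs_loop_cons (b := b) (l := x) (t := 0) _ _ IH) => //.
by rewrite pi; case: b; apply: runs_skip.
Qed.

(* [S k x y] is the store after [k] rounds, with contents [x] of the counter [i] and
   [y] of the stack [t] that collects the used part of the counter. *)
Lemma runs_for i t body (S : nat -> seq bool -> seq bool -> store) a c u :
  (forall k x y, get (S k x y) i = x) -> (forall k x y, get (S k x y) t = y) ->
  (forall k x y z, put (S k x y) i z = S k z y) ->
  (forall k x y z, put (S k x y) t z = S k x z) ->
  (forall k, k < a -> let x := nseq (a - k.+1) true in let y := nseq k true in
     runs body (S k x y) (S k.+1 x y) c) ->
  a * (c + 4) + 2 <= u ->
  runs (hfor i t body) (S 0 (nseq a true) [::]) (S a (nseq a true) [::]) u.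
Proof.
move=> gi gt pi pt Hb Hu.
have loop d k : d + k = a ->
    runs (HLoop i (body ;; HPush t true) (body ;; HPush t true))
      (S k (nseq d true) (nseq k true)) (S a [::] (nseq a true)) (d * (c + 2) + 1).
  elim: d k => [|d IH] k dk.
    by rewrite -dk; apply: runs_loop_nil; rewrite ?gi //; lia.
  have ka : k < a by lia.
  have Hd : d = a - k.+1 by lia.
  apply: (runs_loop_cons (b := true) (l := nseq d true) (t := c + 1)
    (s1 := S k.+1 (nseq d true) (nseq k.+1 true)) _ _ (IH k.+1 _)).
  - by rewrite gi.
  - rewrite pi /= {1 2}Hd; apply: (runs_seq (Hb k ka) _ (leqnn _)).
    by have := @runs_push t true (S k.+1 (nseq (a - k.+1) true) (nseq k true)) 1 isT; rewrite gt pt.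
  - by lia.
  - by lia.
have back : runs (hmove t i) (S a [::] (nseq a true)) (S a (nseq a true) [::]) (2 * a + 1).
  have := @runs_move t i (fun y x => S a x y) a 0 (2 * a + 1); rewrite addn0.
  by apply=> //; rewrite addn1.
by apply: runs_seq (loop a 0 (addn0 a)) back _; lia.
Qed.

Definition st (o i n tn m tm t a h p f nm g n2 t2 : seq bool) : store :=
  [:: o; i; n; tn; m; tm; t; a; h; p; f; nm; g; n2; t2].

(* NN, MM and NB hold n, m and n in unary; TN, TM, TT and TB collect the used part of
   a counter during a loop; AA, HH and PP serve the conversions between unary and
   binary; FF is the flag of a loop that ends on the data read; NM and GG hold the
   numbers of public goods and of public agents. *)
Notation OUT := 0.
Notation IN := 1.
Notation NN := 2.
Notation TN := 3.
Notation MM := 4.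
Notation TM := 5.
Notation TT := 6.
Notation AA := 7.
Notation HH := 8.
Notation PP := 9.
Notation FF := 10.
Notation NM := 11.
Notation GG := 12.
Notation NB := 13.
Notation TB := 14.
Notation un k := (nseq k true).

Ltac hnorm := lazy beta iota zeta delta [nth set_nth st].
Ltac hpush := apply: runs_push.
Ltac hloop c H := eapply (runs_loop_cons (t := c)); [reflexivity | | exact: H | try by lia]; hnorm.
Ltac hloopu c H := eapply (runs_loop_un (t := c)); [reflexivity | | exact: H | try by lia]; hnorm.
Ltac hcons c := eapply (@runs_case_cons _ _ _ _ _ _ c); [reflexivity | | try by lia]; hnorm.
Ltac hnil c := eapply (@runs_case_nil _ _ _ _ _ _ c); [reflexivity | | try by lia]; hnorm.
Ltac hpushs c := eapply (runs_seq (t1 := c)); [by apply: (@runs_push _ _ _ 1) | hnorm | try by lia].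
Ltac hseq c H := eapply (runs_seq (t1 := c)); [eapply H; try exact: leqnn | hnorm | try by lia].
(** * Unary and binary numbers *)

Lemma nat_bitsE u : 0 < u -> nat_bits u = odd u :: nat_bits u./2.
Proof.
case: u => [|[|u]] // _.
have E : trunc_log 2 u.+2 = (trunc_log 2 u.+2./2).+1 by rewrite trunc_log2S.
have iotaS k : iota 0 k.+1 = 0 :: [seq i.+1 | i <- iota 0 k] by rewrite -(iotaDl 1).
transitivity [seq odd (u.+2 %/ 2 ^ i) | i <- iota 0 (trunc_log 2 u./2.+1).+2].
  by rewrite /nat_bits E.
rewrite iotaS map_cons -map_comp expn0 divn1; congr (_ :: _).
by apply: eq_map => i /=; rewrite expnS divnMA divn2.
Qed.

Definition bits_val (s : seq bool) : nat := foldr (fun (b : bool) v => b + v.*2) 0 s.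

Lemma nat_bitsK u : bits_val (nat_bits u) = u.
Proof.
elim/ltn_ind: u => -[|u] IH //; rewrite nat_bitsE //.
have lt_half : u.+1./2 < u.+1 by rewrite -divn2 ltn_Pdiv.
transitivity (odd u.+1 + (bits_val (nat_bits u.+1./2)).*2) => //.
by rewrite IH // odd_double_half.
Qed.

(** The left side is the power of two with which [parse] ends, so that stack stays linear in the
    number parsed. *)
Lemma exp_size_nat_bits u : 2 ^ size (nat_bits u) <= 2 * u + 1.
Proof.
case: u => [|u] //; rewrite size_map size_iota expnS.
by have := @trunc_logP 2 u.+1 isT isT; lia.
Qed.

(* Repeated halving of a unary number yields its bits, least significant first. *)
Definition hhalve :=
  let step := HCase AA (HPush PP true) (HPush HH true) (HPush HH true) in HLoop AA step step.

(** The loop test consumes a unit of [AA], which the body restores first. Halving leaves the next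
    bit in [PP] and the quotient in [HH], from where it returns to [AA]. *)
Definition emitA :=
  let body := HPush AA true ;; hhalve ;; HPush OUT true ;;
    HCase PP (HPush OUT false) (HPush OUT true) (HPush OUT true) ;; hmove HH AA in
  HLoop AA body body ;; HPush OUT false ;; HPush OUT false.

Lemma runs_halve u h o i n tn m tm t f nm g n2 t2 v : 3 * u < v ->
  runs hhalve (st o i n tn m tm t (un u) (un h) [::] f nm g n2 t2)
    (st o i n tn m tm t [::] (un (u./2 + h)) (nseq (odd u) true) f nm g n2 t2) v.
Proof.
move=> Hv; apply: runs_leq Hv _.
elim/ltn_ind: u h => -[|[|u]] IH h.
- exact: runs_loop_nil.
- eapply (runs_loop_cons (t := 2) (t1 := 1)); [reflexivity | | by apply: runs_loop_nil | by lia]; hnorm.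
  by hnil 1; hpush.
- have -> : u.+2./2 + h = u./2 + h.+1 by rewrite addnS.
  have -> : odd u.+2 = odd u by rewrite /= negbK.
  hloopu 2 (IH u (ltnW (ltnSn _)) h.+1).
  by hcons 1; hpush.
Qed.

Lemma runs_emitA u o i n tn m tm t f nm g n2 t2 v : 40 * u + 5 <= v ->
  runs emitA (st o i n tn m tm t (un u) [::] [::] f nm g n2 t2)
    (st (catrev (enc_nat u) o) i n tn m tm t [::] [::] [::] f nm g n2 t2) v.
Proof.
move=> Hv; apply: runs_leq Hv _.
rewrite /emitA; cbv zeta; set b := (HPush AA true ;; _).
suff loop : runs (HLoop AA b b)
    (st o i n tn m tm t (un u) [::] [::] f nm g n2 t2)
    (st (catrev (flatten [seq [:: true; b] | b <- nat_bits u]) o) i n tn m tm t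
       [::] [::] [::] f nm g n2 t2) (40 * u + 3).
  rewrite /enc_nat catrev_catl.
  apply: (runs_seq loop (t1 := 2)); last by lia.
  by hpushs 1; hpush.
elim/ltn_ind: u o => -[|u] IH o; first exact: runs_loop_nil.
have lt_half : u.+1./2 < u.+1 by rewrite -divn2 ltn_Pdiv.
rewrite nat_bitsE //.
hloopu (4 * u + 13) (IH _ lt_half (odd u.+1 :: true :: o)).
hpushs (4 * u + 12).
hseq (u + 8) (@runs_halve u.+1 0).
hpushs (u + 7).
apply: (runs_seq (t := 2) (t1 := u + 3)
  (s1 := st (odd u.+1 :: true :: o) i n tn m tm t [::] (un u.+1./2) [::] f nm g n2 t2)).
- rewrite /= addn0; case: (~~ odd u) => /=.
    by hcons 1; hpush.
  by hnil 1; hpush.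
- have := @runs_move HH AA (fun x y => st (odd u.+1 :: true :: o) i n tn m tm t y x [::] f nm g n2 t2)
    (u.+1./2) 0 (u + 3); rewrite addn0; apply=> //.
  by lia.
- by lia.
Qed.

Definition emit x := hfor x TT (HPush AA true) ;; emitA.

Lemma runs_emit_M u o i n tn tm f nm g n2 t2 v : 50 * u + 20 <= v ->
  runs (emit MM) (st o i n tn (un u) tm [::] [::] [::] [::] f nm g n2 t2)
    (st (catrev (enc_nat u) o) i n tn (un u) tm [::] [::] [::] [::] f nm g n2 t2) v.
Proof.
move=> Hv; have copy := @runs_for MM TT (HPush AA true)
  (fun k x y => st o i n tn x tm y (un k) [::] [::] f nm g n2 t2) u 1 _ _ _ _ _ _ (leqnn _).
apply: (runs_seq (copy _ _ _ _ _) (runs_emitA _ _ _ _ _ _ _ _ _ _ _ _ (leqnn _))) => //.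
  by move=> k _ x y; apply: runs_push.
lia.
Qed.

Lemma runs_emit_NM u o i n tn m tm f g n2 t2 v : 50 * u + 20 <= v ->
  runs (emit NM) (st o i n tn m tm [::] [::] [::] [::] f (un u) g n2 t2)
    (st (catrev (enc_nat u) o) i n tn m tm [::] [::] [::] [::] f (un u) g n2 t2) v.
Proof.
move=> Hv; have copy := @runs_for NM TT (HPush AA true)
  (fun k x y => st o i n tn m tm y (un k) [::] [::] f x g n2 t2) u 1 _ _ _ _ _ _ (leqnn _).
apply: (runs_seq (copy _ _ _ _ _) (runs_emitA _ _ _ _ _ _ _ _ _ _ _ _ (leqnn _))) => //.
  by move=> k _ x y; apply: runs_push.
lia.
Qed.

Lemma runs_emit_G u o i n tn m tm f nm n2 t2 v : 50 * u + 20 <= v ->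
  runs (emit GG) (st o i n tn m tm [::] [::] [::] [::] f nm (un u) n2 t2)
    (st (catrev (enc_nat u) o) i n tn m tm [::] [::] [::] [::] f nm (un u) n2 t2) v.
Proof.
move=> Hv; have copy := @runs_for GG TT (HPush AA true)
  (fun k x y => st o i n tn m tm y (un k) [::] [::] f nm x n2 t2) u 1 _ _ _ _ _ _ (leqnn _).
apply: (runs_seq (copy _ _ _ _ _) (runs_emitA _ _ _ _ _ _ _ _ _ _ _ _ (leqnn _))) => //.
  by move=> k _ x y; apply: runs_push.
lia.
Qed.

(* The bits come least significant first, so PP holds the current power of two. *)
Definition parse :=
  let continue := HLoop PP (HPush TT true ;; HPush TT true) (HPush TT true ;; HPush TT true) ;;
    hmove TT PP ;; HPush FF true in
  let body := HCase IN HSkip (HCase IN HSkip HSkip HSkip)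
    (HCase IN HSkip continue (hfor PP TT (HPush AA true) ;; continue)) in
  HPush PP true ;; HPush FF true ;; HLoop FF body body ;; hclear PP.

Lemma runs_parse u o i n tn m tm h nm g n2 t2 v : 60 * u + 60 <= v ->
  runs parse (st o (enc_nat u ++ i) n tn m tm [::] [::] h [::] [::] nm g n2 t2)
    (st o i n tn m tm [::] (un u) h [::] [::] nm g n2 t2) v.
Proof.
move=> Hv; apply: runs_leq Hv _.
rewrite /parse; cbv zeta; set C := (HLoop PP _ _ ;; _); set B := HCase IN _ _ _.
pose S a p f i := st o i n tn m tm [::] (un a) h (un p) f nm g n2 t2.
have runC a p i' : runs C (S a p [::] i') (S a p.*2 [:: true] i') (7 * p + 3).
  have dbl q r : runs (HLoop PP (HPush TT true ;; HPush TT true) (HPush TT true ;; HPush TT true))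
      (st o i' n tn m tm (un r) (un a) h (un q) [::] nm g n2 t2)
      (st o i' n tn m tm (un (q.*2 + r)) (un a) h [::] [::] nm g n2 t2) (3 * q + 1).
    elim: q r => [|q IH] r; first exact: runs_loop_nil.
    have -> : q.+1.*2 + r = q.*2 + r.+2 by lia.
    hloopu 2 (IH r.+2).
    by hpushs 1; hpush.
  apply: (runs_seq (dbl p 0) (t1 := 4 * p + 2)); last by lia.
  apply: (runs_seq (t := 4 * p + 1) (t1 := 1) (s1 := S a p.*2 [::] i')); last by lia.
    2: by hpush.
  have := @runs_move TT PP (fun x y => st o i' n tn m tm x (un a) h y [::] nm g n2 t2)
    p.*2 0 (4 * p + 1); rewrite !addn0; apply=> //.
  by lia.
have loop bs a p : 0 < p -> exists2 c, c + 25 * p <= 25 * p * 2 ^ size bs + 4 &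
    runs (HLoop FF B B) (S a p [:: true] (flatten [seq [:: true; b] | b <- bs] ++ false :: false :: i))
      (S (a + p * bits_val bs) (p * 2 ^ size bs) [::] i) c.
  elim: bs a p => [|b bs IH] a p p0.
    exists 4; first by rewrite expn0; lia.
    rewrite muln0 addn0 muln1.
    eapply (runs_loop_cons (t := 2) (t1 := 1)); [reflexivity | | by apply: runs_loop_nil | by lia]; hnorm.
    by hcons 1; hcons 0; apply: runs_skip.
  have p20 : 0 < p.*2 by lia.
  have [c Hc Hr] := IH (a + b * p) p.*2 p20.
  exists (c + 25 * p); first by rewrite /= expnS; lia.
  have -> : a + p * bits_val (b :: bs) = a + b * p + p.*2 * bits_val bs.
    by rewrite /= -/(bits_val bs); lia.
  have -> : p * 2 ^ size (b :: bs) = p.*2 * 2 ^ size bs by rewrite /= expnS; lia.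
  hloop (12 * p + 9) Hr; hcons (12 * p + 8); hcons (12 * p + 7).
  case: b {Hr}; last first.
    by rewrite mul0n addn0; apply: runs_leq (runC _ _ _); lia.
  rewrite mul1n.
  have add := @runs_for PP TT (HPush AA true)
    (fun k x y => st o (flatten [seq [:: true; b] | b <- bs] ++ false :: false :: i) n tn m tm y
       (un (k + a)) h x [::] nm g n2 t2) p 1 _ _ _ _ _ _ (leqnn _).
  rewrite addnC.
  apply: (runs_seq (add _ _ _ _ _) (runC _ _ _)) => //.
    by move=> k _ x y; apply: runs_push.
  lia.
have [c Hc Hr] := loop (nat_bits u) 0 1 isT.
have Hp := exp_size_nat_bits u.
rewrite nat_bitsK mul1n in Hr; rewrite mul1n in Hr.
hpushs (60 * u + 59).
hpushs (60 * u + 58).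
have cl := @runs_clear PP (fun x => st o i n tn m tm [::] (un u) h x [::] nm g n2 t2)
  (un (2 ^ size (nat_bits u))) _ _ _ (leqnn _).
rewrite /enc_nat -catA; apply: (runs_seq Hr (cl _ _)) => //.
by rewrite size_nseq; lia.
Qed.
Lemma flatten_mkseqS (T : Type) (e : nat -> seq T) k :
  flatten (mkseq e k.+1) = flatten (mkseq e k) ++ e k.
Proof. by rewrite /mkseq -addn1 iotaD map_cat flatten_cat /= cats0. Qed.

Lemma iota_subS k a : k < a -> iota k (a - k) = k :: iota k.+1 (a - k.+1).
Proof. by move=> ka; rewrite subnS -[a - k]prednK // subn_gt0. Qed.

Lemma runs_for_io i t body (S : seq bool -> seq bool -> seq bool -> seq bool -> store)
    (ein eout : nat -> seq bool) a c u o inp :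
  (forall o i' x y, get (S o i' x y) i = x) -> (forall o i' x y, get (S o i' x y) t = y) ->
  (forall o i' x y z, put (S o i' x y) i z = S o i' z y) ->
  (forall o i' x y z, put (S o i' x y) t z = S o i' x z) ->
  (forall k o i', k < a -> let x := nseq (a - k.+1) true in let y := nseq k true in
     runs body (S o (ein k ++ i') x y) (S (catrev (eout k) o) i' x y) c) ->
  a * (c + 4) + 2 <= u ->
  runs (hfor i t body) (S o (flatten (mkseq ein a) ++ inp) (nseq a true) [::])
    (S (catrev (flatten (mkseq eout a)) o) inp (nseq a true) [::]) u.
Proof.
move=> gi gt pi pt Hb Hu.
pose F k x y := S (catrev (flatten (mkseq eout k)) o)
  (flatten [seq ein j | j <- iota k (a - k)] ++ inp) x y.
have := @runs_for i t body F a c u; rewrite /F subn0 subnn; apply.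
- by move=> *; apply: gi.
- by move=> *; apply: gt.
- by move=> *; apply: pi.
- by move=> *; apply: pt.
- move=> k ka.
rewrite (iota_subS ka) flatten_mkseqS catrev_catl.
by have := Hb k (catrev (flatten (mkseq eout k)) o)
  (flatten [seq ein j | j <- iota k.+1 (a - k.+1)] ++ inp) ka; rewrite /= -catA.
- exact: Hu.
Qed.

Definition copy_nat :=
  let body := HCase IN HSkip
    (HCase IN HSkip HSkip HSkip ;; HPush OUT false ;; HPush OUT false)
    (HPush OUT true ;; HCase IN HSkip (HPush OUT false) (HPush OUT true) ;; HPush FF true) in
  HPush FF true ;; HLoop FF body body.

Lemma runs_copy_nat u o i n tn m tm t a h p nm g n2 t2 v : 10 * size (enc_nat u) + 10 <= v ->
  runs copy_nat (st o (enc_nat u ++ i) n tn m tm t a h p [::] nm g n2 t2)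
    (st (catrev (enc_nat u) o) i n tn m tm t a h p [::] nm g n2 t2) v.
Proof.
move=> Hv; apply: runs_leq Hv _.
rewrite /copy_nat; cbv zeta; set b := HCase IN _ _ _.
hpushs (10 * size (enc_nat u) + 9).
rewrite /enc_nat; elim: (nat_bits u) o => [|c bs IH] o.
  eapply (runs_loop_cons (t := 5) (t1 := 1)); [reflexivity | | by apply: runs_loop_nil | by lia]; hnorm.
  hcons 4; apply: (runs_seq (t := 1) (t1 := 2) (s1 := st o i n tn m tm t a h p [::] nm g n2 t2)) => //.
    by hcons 0; apply: runs_skip.
  by hpushs 1; hpush.
hloop 5 (IH (c :: true :: o)); last by rewrite /=; lia.
hcons 4; hpushs 3.
apply: (runs_seq (t1 := 1) (t := 2) (s1 := st (c :: true :: o)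
  ((flatten [seq [:: true; b] | b <- bs] ++ [:: false; false]) ++ i)
  n tn m tm t a h p [::] nm g n2 t2)) => //; last by hpush.
by hcons 1; case: c; hpush.
Qed.

Definition zero := HPush OUT false ;; HPush OUT false.
Definition one := HPush OUT true ;; HPush OUT true ;; HPush OUT false ;; HPush OUT false.

Lemma runs_zero o s : runs zero (o :: s) (catrev (enc_nat 0) o :: s) 2.
Proof. by hpushs 1; hpush. Qed.

Lemma runs_one o s : runs one (o :: s) (catrev (enc_nat 1) o :: s) 4.
Proof. by hpushs 3; hpushs 2; hpushs 1; hpush. Qed.

Definition enc_const k x : seq bool := flatten (mkseq (fun=> enc_nat x) k).

Definition hinit := HPush TB true ;; hclear TB ;; HLoop OUT (HPush IN false) (HPush IN true).

Lemma runs_init w : runs hinit [:: rev w]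
  (st [::] w [::] [::] [::] [::] [::] [::] [::] [::] [::] [::] [::] [::] [::]) (2 * size w + 4).
Proof.
hpushs (2 * size w + 3).
have cl := @runs_clear TB (fun x => st (rev w) [::] [::] [::] [::] [::] [::] [::] [::] [::] [::]
  [::] [::] [::] x) [:: true] 2.
apply: (runs_seq (cl _ _ _) (t1 := 2 * size w + 1)) => //; last by lia.
suff H : forall i, runs (HLoop OUT (HPush IN false) (HPush IN true))
    (st (rev w) i [::] [::] [::] [::] [::] [::] [::] [::] [::] [::] [::] [::] [::])
    (st [::] (catrev (rev w) i) [::] [::] [::] [::] [::] [::] [::] [::] [::] [::] [::] [::] [::])
    (2 * size w + 1).
  by have := H [::]; rewrite -[catrev _ _]/(rev (rev w)) revK.
rewrite -size_rev; elim: (rev w) => [|b s IH] i; first by apply: runs_loop_nil.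
hloop 1 (IH (b :: i)); last by rewrite /=; lia.
by case: b; hpush.
Qed.

Definition hread := parse ;; hmove AA NN ;; parse ;; hmove AA MM ;; parse ;; hmove AA NB.

Lemma runs_read n m i v : 200 * (n + m + 1) <= v ->
  runs hread (st [::] (enc_nat n ++ enc_nat m ++ enc_nat n ++ i) [::] [::] [::] [::] [::]
      [::] [::] [::] [::] [::] [::] [::] [::])
    (st [::] i (un n) [::] (un m) [::] [::] [::] [::] [::] [::] [::] [::] (un n) [::]) v.
Proof.
move=> Hv.
have mvN i' : runs (hmove AA NN)
    (st [::] i' [::] [::] [::] [::] [::] (un n) [::] [::] [::] [::] [::] [::] [::])
    (st [::] i' (un n) [::] [::] [::] [::] [::] [::] [::] [::] [::] [::] [::] [::]) (2 * n + 1).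
  have := @runs_move AA NN (fun x y => st [::] i' y [::] [::] [::] [::] x
    [::] [::] [::] [::] [::] [::] [::]) n 0 (2 * n + 1).
  by rewrite addn0 addn1; apply.
have mvM i' : runs (hmove AA MM)
    (st [::] i' (un n) [::] [::] [::] [::] (un m) [::] [::] [::] [::] [::] [::] [::])
    (st [::] i' (un n) [::] (un m) [::] [::] [::] [::] [::] [::] [::] [::] [::] [::]) (2 * m + 1).
  have := @runs_move AA MM (fun x y => st [::] i' (un n) [::] y [::] [::] x
    [::] [::] [::] [::] [::] [::] [::]) m 0 (2 * m + 1).
  by rewrite addn0 addn1; apply.
have mvB i' : runs (hmove AA NB)
    (st [::] i' (un n) [::] (un m) [::] [::] (un n) [::] [::] [::] [::] [::] [::] [::])
    (st [::] i' (un n) [::] (un m) [::] [::] [::] [::] [::] [::] [::] [::] (un n) [::]) (2 * n + 1).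
  have := @runs_move AA NB (fun x y => st [::] i' (un n) [::] (un m) [::] [::] x
    [::] [::] [::] [::] [::] y [::]) n 0 (2 * n + 1).
  by rewrite addn0 addn1; apply.
hseq (140 * n + 140 * m + 140) @runs_parse.
hseq (138 * n + 139 * m + 139) @mvN.
hseq (78 * n + 79 * m + 79) @runs_parse.
hseq (78 * n + 77 * m + 78) @mvM.
hseq (2 * n + 1) @runs_parse.
exact: mvB.
Qed.

Definition sizes :=
  hfor NN TN (HPush GG true) ;;
  hfor MM TM (HPush GG true ;; hfor NN TN (HPush GG true ;; HPush NM true)).

Lemma runs_sizes n m i n2 v : 20 * (n + 1) * (m + 1) <= v ->
  runs sizes
    (st [::] i (un n) [::] (un m) [::] [::] [::] [::] [::] [::] [::] [::] n2 [::])
    (st [::] i (un n) [::] (un m) [::] [::] [::] [::] [::] [::]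
       (un (m * n)) (un (n + n.+1 * m)) n2 [::]) v.
Proof.
move=> Hv.
have loop1 := @runs_for NN TN (HPush GG true) (fun k x y => st [::] i x y (un m) [::]
  [::] [::] [::] [::] [::] [::] (un k) n2 [::]) n 1 _ _ _ _ _ _ (leqnn _).
have loop2 k x y := @runs_for NN TN (HPush GG true ;; HPush NM true) (fun j x' y' =>
  st [::] i x' y' x y [::] [::] [::] [::] [::] (un (j + k * n)) (un (j + (n + n.+1 * k).+1)) n2 [::])
  n 2 _ _ _ _ _ _ (leqnn _).
have loop3 := @runs_for MM TM (HPush GG true ;; hfor NN TN (HPush GG true ;; HPush NM true))
  (fun k x y => st [::] i (un n) [::] x y [::] [::] [::] [::] [::]
    (un (k * n)) (un (n + n.+1 * k)) n2 [::]) m (n * (2 + 4) + 3) _ _ _ _ _ _ (leqnn _).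
rewrite muln0 addn0 in loop3.
apply: (runs_seq (loop1 _ _ _ _ _) (loop3 _ _ _ _ _)) => //.
- by move=> k _ x y; hpush.
- move=> k km x y; hpushs (n * (2 + 4) + 2).
  have -> : k.+1 * n = n + k * n by rewrite mulSn.
  have -> : n + n.+1 * k.+1 = n + (n + n.+1 * k).+1 by rewrite mulnS; lia.
  apply: loop2 => //.
  by move=> * ; hpushs 1; hpush.
- by lia.
Qed.
Lemma runs_for_out i t body (S : seq bool -> seq bool -> seq bool -> store)
    (eout : nat -> seq bool) a c u o :
  (forall o x y, get (S o x y) i = x) -> (forall o x y, get (S o x y) t = y) ->
  (forall o x y z, put (S o x y) i z = S o z y) ->
  (forall o x y z, put (S o x y) t z = S o x z) ->
  (forall k o, k < a -> let x := nseq (a - k.+1) true in let y := nseq k true in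
     runs body (S o x y) (S (catrev (eout k) o) x y) c) ->
  a * (c + 4) + 2 <= u ->
  runs (hfor i t body) (S o (nseq a true) [::])
    (S (catrev (flatten (mkseq eout a)) o) (nseq a true) [::]) u.
Proof.
move=> gi gt pi pt Hb Hu.
have := @runs_for_io i t body (fun o _ x y => S o x y) (fun=> [::]) eout a c u o [::].
by apply=> // k o' _ ka; apply: Hb.
Qed.

Definition agent_rows :=
  hfor NN TN (emit NM ;; parse ;; hclear AA ;;
    hfor MM TM (hfor TN TB zero ;; copy_nat ;; hfor NN TB zero)).

Lemma runs_agent_rows n m q L (v : nat -> nat -> nat) o inp g n2 u :
  (forall i j, i < n -> j < m -> size (enc_nat (v i j)) <= L) ->
  n * (200 + 50 * q + 70 * m + m * (12 * n + 10 * L + 30)) + 2 <= u ->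
  runs agent_rows
    (st o (flatten (mkseq (fun i => enc_nat m ++ flatten (mkseq (fun j => enc_nat (v i j)) m)) n)
            ++ inp) (un n) [::] (un m) [::] [::] [::] [::] [::] [::] (un q) g n2 [::])
    (st (catrev (flatten (mkseq (fun i => enc_nat q ++ flatten (mkseq (fun j =>
            enc_const i 0 ++ enc_nat (v i j) ++ enc_const (n - i.+1) 0) m)) n)) o)
        inp (un n) [::] (un m) [::] [::] [::] [::] [::] [::] (un q) g n2 [::]) u.
Proof.
move=> HL Hu.
apply: (@runs_for_io NN TN _ (fun o i x y => st o i x y (un m) [::] [::] [::] [::] [::] [::]
  (un q) g n2 [::]) _ _ n (196 + 50 * q + 70 * m + m * (12 * n + 10 * L + 30))) => //;
  last by lia.
move=> i o' i' ltin x y; rewrite /= -catA catrev_catl.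
hseq (176 + 70 * m + m * (12 * n + 10 * L + 30)) @runs_emit_NM.
hseq (116 + 10 * m + m * (12 * n + 10 * L + 30)) @runs_parse.
hseq (114 + 9 * m + m * (12 * n + 10 * L + 30))
  (@runs_clear AA (fun z => st (catrev (enc_nat q) o')
     (flatten (mkseq (fun j => enc_nat (v i j)) m) ++ i') x y (un m) [::] [::] z [::] [::] [::]
     (un q) g n2 [::]) (un m)) => //; last by rewrite size_nseq; lia.
apply: (@runs_for_io MM TM _ (fun o i' z w => st o i' x y z w [::] [::] [::] [::] [::]
  (un q) g n2 [::]) _ _ m (12 * n + 10 * L + 20)) => //; last by lia.
move=> j o2 i2 ltjm z w; rewrite (catrev_catl (enc_const i 0)) (catrev_catl (enc_nat (v i j))).
apply: (runs_seq (t := i * 6 + 2) (t1 := 6 * (n - i.+1) + 10 * L + 14)); last by lia.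
  apply: (@runs_for_out TN TB _ (fun o z' w' => st o (enc_nat (v i j) ++ i2) x z' z w
    [::] [::] [::] [::] [::] (un q) g n2 w') _ i 2) => //.
  by move=> k o3 _ z' w'; apply: runs_zero.
hseq (6 * (n - i.+1) + 2) @runs_copy_nat; last first.
- by have := HL i j ltin ltjm; lia.
apply: (@runs_for_out NN TB _ (fun o z' w' => st o i2 z' y z w
  [::] [::] [::] [::] [::] (un q) g n2 w') _ (n - i.+1) 2) => //; last by lia.
by move=> k o3 _ z' w'; apply: runs_zero.
Qed.

Definition const_block b := hfor NB TB b.
Definition good_rows :=
  hfor MM TM (emit NM ;; hfor TM TT (const_block zero) ;; const_block one ;;
    hfor MM TT (const_block zero)).

Lemma runs_const_block b c e o i n tn m tm t a h p f nm g k u :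
  (forall o s, runs b (o :: s) (catrev e o :: s) c) -> k * (c + 4) + 2 <= u ->
  runs (const_block b) (st o i n tn m tm t a h p f nm g (un k) [::])
    (st (catrev (flatten (mkseq (fun=> e) k)) o) i n tn m tm t a h p f nm g (un k) [::]) u.
Proof.
move=> Hb Hu.
apply: (@runs_for_out NB TB _ (fun o x y => st o i n tn m tm t a h p f nm g x y) _ k c) => //.
by move=> j o' _ x y; apply: Hb.
Qed.

Definition good_row_code q n m j : seq bool :=
  enc_nat q ++ flatten (mkseq (fun=> enc_const n 0) j) ++ enc_const n 1 ++
  flatten (mkseq (fun=> enc_const n 0) (m - j.+1)).

Lemma runs_good_rows n m q o i x y f g u :
  m * (50 * q + 8 * n + m * (6 * n + 6) + 40) + 2 <= u ->
  runs good_rows (st o i x y (un m) [::] [::] [::] [::] [::] f (un q) g (un n) [::])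
    (st (catrev (flatten (mkseq (good_row_code q n m) m)) o) i x y (un m) [::]
        [::] [::] [::] [::] f (un q) g (un n) [::]) u.
Proof.
move=> Hu.
apply: (@runs_for_out MM TM _ (fun o z w => st o i x y z w [::] [::] [::] [::] f (un q) g (un n) [::])
  _ m (50 * q + 8 * n + m * (6 * n + 6) + 36)) => //; last by lia.
move=> j o' ltjm z w; rewrite /good_row_code (catrev_catl (enc_nat q)).
rewrite (catrev_catl (flatten _)) (catrev_catl (enc_const n 1)).
hseq (8 * n + m * (6 * n + 6) + 16) @runs_emit_NM.
apply: (runs_seq (t := j * (6 * n + 6) + 2) (t1 := 8 * n + (m - j.+1) * (6 * n + 6) + 6)).
- apply: (@runs_for_out TM TT _ (fun o z' w' => st o i x y z z' w' [::] [::] [::] f (un q) g (un n) [::])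
    _ j (6 * n + 2)) => //; last by lia.
  by move=> k o2 _ z' w'; eapply runs_const_block; [exact: runs_zero | lia].
- eapply (runs_seq (t1 := (m - j.+1) * (6 * n + 6) + 2));
    [eapply runs_const_block; [exact: runs_one | exact: leqnn] | | by lia].
  apply: (@runs_for_out MM TT _ (fun o z' w' => st o i x y z' w w' [::] [::] [::] f (un q) g (un n) [::])
    _ (m - j.+1) (6 * n + 2)) => //; last by lia.
  by move=> k o2 _ z' w'; eapply runs_const_block; [exact: runs_zero | lia].
- have -> : m = j + (m - j.+1) + 1 by lia.
  have -> : j + (m - j.+1) + 1 - j.+1 = m - j.+1 by lia.
  by rewrite !mulnDl; lia.
Qed.

Definition reduce_prog :=
  hinit ;; hread ;; sizes ;; emit GG ;; emit NM ;; emit MM ;; emit GG ;; agent_rows ;;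
  hfor NN TN good_rows ;; good_rows.

Definition priv_code n m (v : nat -> nat -> nat) : seq bool :=
  enc_nat n ++ enc_nat m ++ enc_nat n ++
  flatten (mkseq (fun i => enc_nat m ++ flatten (mkseq (fun j => enc_nat (v i j)) m)) n).

Definition pub_code n m (v : nat -> nat -> nat) : seq bool :=
  enc_nat (n + n.+1 * m) ++ enc_nat (m * n) ++ enc_nat m ++ enc_nat (n + n.+1 * m) ++
  flatten (mkseq (fun i => enc_nat (m * n) ++ flatten (mkseq (fun j =>
    enc_const i 0 ++ enc_nat (v i j) ++ enc_const (n - i.+1) 0) m)) n) ++
  flatten (mkseq (fun=> flatten (mkseq (good_row_code (m * n) n m) m)) n.+1).

Definition good_time N := N * (50 * (N * N) + 8 * N + N * (6 * N + 6) + 40) + 2.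
Definition reduce_time N :=
  (2 * N + 4) + (200 * (N + N + 1) + (20 * (N + 1) * (N + 1) +
  ((50 * (N + N.+1 * N) + 20) + ((50 * (N * N) + 20) + ((50 * N + 20) +
  ((50 * (N + N.+1 * N) + 20) +
  ((N * (200 + 50 * (N * N) + 70 * N + N * (12 * N + 10 * N + 30)) + 2) +
  ((N * (good_time N + 4) + 2) + good_time N)))))))).

Ltac mono := do ?[apply: leq_mul | apply: leq_add | by []].
Ltac hstep L := eapply runs_seq; [| | exact: leqnn]; [eapply L; mono | hnorm].

Lemma runs_reduce_prog n m (v : nat -> nat -> nat) N :
  n <= N -> m <= N -> (forall i j, i < n -> j < m -> size (enc_nat (v i j)) <= N) ->
  size (priv_code n m v) <= N ->
  exists s, runs reduce_prog [:: rev (priv_code n m v)] s (reduce_time N) /\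
    get s 0 = rev (pub_code n m v).
Proof.
move=> nN mN vN cN.
have good o x y : runs good_rows
    (st o [::] x y (un m) [::] [::] [::] [::] [::] [::] (un (m * n)) (un (n + n.+1 * m)) (un n) [::])
    (st (catrev (flatten (mkseq (good_row_code (m * n) n m) m)) o) [::] x y (un m) [::]
       [::] [::] [::] [::] [::] (un (m * n)) (un (n + n.+1 * m)) (un n) [::]) (good_time N).
  by apply: runs_good_rows; rewrite /good_time; mono.
have rowsE : priv_code n m v = enc_nat n ++ enc_nat m ++ enc_nat n ++ (flatten
    (mkseq (fun i => enc_nat m ++ flatten (mkseq (fun j => enc_nat (v i j)) m)) n) ++ [::]).
  by rewrite cats0.
eexists; split.
- rewrite /reduce_time; eapply runs_seq; [| | exact: leqnn]; [apply: runs_leq (runs_init _); mono | hnorm].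
  rewrite rowsE; hstep @runs_read.
  hstep @runs_sizes.
  hstep @runs_emit_G.
  hstep @runs_emit_NM.
  hstep @runs_emit_M.
  hstep @runs_emit_G.
  hstep (@runs_agent_rows n m (m * n) N v).
  hstep (@runs_for_out NN TN good_rows (fun o x y => st o [::] x y (un m) [::] [::] [::] [::] [::] [::]
    (un (m * n)) (un (n + n.+1 * m)) (un n) [::])
    (fun=> flatten (mkseq (good_row_code (m * n) n m) m)) n (good_time N)).
  exact: good.
- rewrite /= /pub_code flatten_mkseqS !catA /rev.
  by rewrite !catrev_catl.
Qed.
Lemma flatten_mkseqD (T : Type) (g : nat -> seq T) a b :
  flatten (mkseq g (a + b)) = flatten (mkseq g a) ++ flatten (mkseq (fun i => g (a + i)) b).
Proof.
elim: b => [|b IH]; first by rewrite addn0 cats0.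
by rewrite addnS !flatten_mkseqS IH catA.
Qed.

Lemma flatten_mkseqM (T : Type) (g : nat -> seq T) m n :
  flatten (mkseq g (m * n)) =
  flatten (mkseq (fun j => flatten (mkseq (fun i => g (j * n + i)) n)) m).
Proof.
elim: m => [|m IH]; first by rewrite mul0n.
by rewrite mulSn addnC flatten_mkseqD IH flatten_mkseqS.
Qed.

Lemma eq_in_mkseq (T : Type) (f g : nat -> T) n :
  (forall i, i < n -> f i = g i) -> mkseq f n = mkseq g n.
Proof. by move=> fg; apply/eq_in_map => i; rewrite mem_iota => /fg. Qed.

Lemma flatten_mkseq1 (T : Type) (g : nat -> seq T) x y i n : i < n ->
  (forall k, k < n -> g k = if k == i then x else y) ->
  flatten (mkseq g n) =
  flatten (mkseq (fun=> y) i) ++ x ++ flatten (mkseq (fun=> y) (n - i.+1)).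
Proof.
move=> ltin gE; have nE : n = i + (1 + (n - i.+1)) by lia.
rewrite {1}nE flatten_mkseqD flatten_mkseqD /= cats0 addn0.
rewrite (gE i ltin) eqxx; congr (_ ++ (_ ++ _)); congr flatten.
  by apply: eq_in_mkseq => k ki; rewrite gE; [case: eqP => // ?; exfalso; lia | lia].
by apply: eq_in_mkseq => k ki; rewrite gE; [case: eqP => // ?; exfalso; lia | lia].
Qed.

Lemma map_mkseq (S T : Type) (e : S -> T) (f : nat -> S) n :
  map e (mkseq f n) = mkseq (fun i => e (f i)) n.
Proof. by rewrite -map_comp. Qed.

Lemma enc_seq_mkseq (T : Type) (e : T -> seq bool) (f : nat -> T) n :
  enc_seq e (mkseq f n) = enc_nat n ++ flatten (mkseq (fun i => e (f i)) n).
Proof. by rewrite /enc_seq size_mkseq map_mkseq. Qed.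

Lemma enc_privE I : priv_wf I ->
  enc_priv I = priv_code (pr_n I) (pr_m I) (Defs.val (pr_v I)).
Proof.
move=> [_ [sv /allP wf]]; rewrite /enc_priv /priv_code; congr (_ ++ (_ ++ _)).
rewrite -{1}(mkseq_nth [::] (pr_v I)) sv enc_seq_mkseq; congr (_ ++ flatten _).
apply: eq_in_mkseq => i ltin.
have /eqP si : size (nth [::] (pr_v I) i) == pr_m I by apply: wf; rewrite mem_nth ?sv.
by rewrite -{1}(mkseq_nth 0 (nth _ _ _)) si enc_seq_mkseq.
Qed.

Lemma enc_agent_row n m i r : i < n ->
  enc_seq enc_nat (agent_row n m i r) = enc_nat (m * n) ++ flatten (mkseq (fun j =>
    enc_const i 0 ++ enc_nat (nth 0 r j) ++ enc_const (n - i.+1) 0) m).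
Proof.
move=> ltin; rewrite enc_seq_mkseq flatten_mkseqM; congr (_ ++ flatten _).
apply: eq_in_mkseq => j _; apply: flatten_mkseq1 => // k ltkn.
rewrite modnMDl modn_small // divnMDl ?divn_small ?addn0; [|lia..].
by case: eqP.
Qed.

Lemma enc_good_row n m j : j < m ->
  enc_seq enc_nat (good_row n m j) = good_row_code (m * n) n m j.
Proof.
move=> ltjm; rewrite enc_seq_mkseq flatten_mkseqM; congr (_ ++ _).
apply: flatten_mkseq1 => // k ltkm.
transitivity (enc_const n (k == j)); last by case: eqP.
congr flatten; apply: eq_in_mkseq => i ltin.
by rewrite divnMDl ?divn_small ?addn0 //; lia.
Qed.

Lemma enc_pubE I :
  enc_pub (reduction I) = pub_code (pr_n I) (pr_m I) (Defs.val (pr_v I)).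
Proof.
rewrite /enc_pub /pub_code [pu_n _]/= [pu_m _]/= [pu_k _]/= [pu_v _]/=; congr (_ ++ (_ ++ (_ ++ _))).
rewrite /enc_seq size_cat !size_mkseq map_cat flatten_cat; congr (_ ++ (_ ++ _)).
  rewrite map_mkseq; congr flatten; apply: eq_in_mkseq => i ltin.
  exact: enc_agent_row.
rewrite map_mkseq flatten_mkseqM; congr flatten; apply: eq_in_mkseq => c _.
congr flatten; apply: eq_in_mkseq => j ltjm.
by rewrite modnMDl modn_small // -enc_good_row.
Qed.

Lemma size_enc_nat u : 1 < size (enc_nat u).
Proof. by rewrite /enc_nat size_cat addnC. Qed.

Lemma leq_size_flatten (T : Type) (g : nat -> seq T) k n : k < n ->
  size (g k) <= size (flatten (mkseq g n)).
Proof.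
move=> kn; have -> : n = k + (1 + (n - k.+1)) by lia.
have g1 : flatten (mkseq (fun i => g (k + i)) 1) = g k by rewrite /= cats0 addn0.
by rewrite !flatten_mkseqD g1 !size_cat; lia.
Qed.

Lemma geq_size_flatten (T : Type) (g : nat -> seq T) n :
  (forall k, 0 < size (g k)) -> n <= size (flatten (mkseq g n)).
Proof.
move=> g0; elim: n => // n IH; rewrite flatten_mkseqS size_cat.
by have := g0 n; lia.
Qed.

Lemma priv_code_bounds n m v : 0 < n ->
  [/\ n <= size (priv_code n m v), m <= size (priv_code n m v) &
   forall i j, i < n -> j < m -> size (enc_nat (v i j)) <= size (priv_code n m v)].
Proof.
move=> n0; rewrite /priv_code !size_cat.
set row := fun i => _ ++ _.
have rown : n <= size (flatten (mkseq row n)).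
  by apply: geq_size_flatten => k; rewrite size_cat; have := size_enc_nat m; lia.
have rowi i : i < n -> size (row i) <= size (flatten (mkseq row n)).
  exact: leq_size_flatten.
have rowm i : m <= size (row i).
  rewrite size_cat; have := @geq_size_flatten _ (fun j => enc_nat (v i j)) m.
  by move/(_ (fun j => ltnW (size_enc_nat _))); lia.
split.
- by lia.
- by have := rowi 0 n0; have := rowm 0; lia.
- move=> i j ltin ltjm; have := rowi i ltin; rewrite size_cat.
  by have := @leq_size_flatten _ (fun j => enc_nat (v i j)) j m ltjm; lia.
Qed.

Lemma poly_bounded_reduce_time : poly_bounded reduce_time.
Proof.
rewrite /reduce_time /good_time.
do ![ exact: poly_bounded_id | exact: poly_bounded_const
    | apply: poly_bounded_add | apply: poly_bounded_mul ].
Qed.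

Lemma poly_time_reduction : poly_time enc_priv enc_pub priv_wf reduction.
Proof.
apply: (@poly_time_hprog _ _ _ _ _ _ reduce_prog _ _ poly_bounded_reduce_time) => // I wfI.
have [n0 _] := wfI; rewrite enc_privE // enc_pubE.
have [nN mN vN] := priv_code_bounds (pr_m I) (Defs.val (pr_v I)) n0.
have [s [[t tN H] E]] := runs_reduce_prog nN mN vN (leqnn _).
by exists t, s.
Qed.
Definition skip_nat :=
  let body := HCase IN HSkip (HCase IN HSkip HSkip HSkip)
    (HCase IN HSkip (HPush FF true) (HPush FF true)) in
  HPush FF true ;; HLoop FF body body.

Lemma runs_skip_nat u o i n tn m tm t a h p nm g n2 t2 v : 10 * size (enc_nat u) + 10 <= v ->
  runs skip_nat (st o (enc_nat u ++ i) n tn m tm t a h p [::] nm g n2 t2)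
    (st o i n tn m tm t a h p [::] nm g n2 t2) v.
Proof.
move=> Hv; apply: runs_leq Hv _.
rewrite /skip_nat; cbv zeta; set b := HCase IN _ _ _.
hpushs (10 * size (enc_nat u) + 9).
rewrite /enc_nat; elim: (nat_bits u) => [|c bs IH].
  eapply (runs_loop_cons (t := 5) (t1 := 1)); [reflexivity | | by apply: runs_loop_nil | by lia]; hnorm.
  by hcons 1; hcons 0; apply: runs_skip.
hloop 5 IH; last by rewrite /=; lia.
by hcons 4; hcons 1; case: c; hpush.
Qed.

Definition skip_rows := hfor NN TN (parse ;; hclear AA ;; hfor MM TM skip_nat).

Lemma runs_skip_rows n m L (v : nat -> nat -> nat) o inp nm g n2 u :
  (forall i j, i < n -> j < m -> size (enc_nat (v i j)) <= L) ->
  n * (m * (10 * L + 90) + 80) + 2 <= u ->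
  runs skip_rows
    (st o (flatten (mkseq (fun i => enc_nat m ++ flatten (mkseq (fun j => enc_nat (v i j)) m)) n)
            ++ inp) (un n) [::] (un m) [::] [::] [::] [::] [::] [::] nm g n2 [::])
    (st o inp (un n) [::] (un m) [::] [::] [::] [::] [::] [::] nm g n2 [::]) u.
Proof.
move=> HL Hu.
apply: (@runs_for_io NN TN _ (fun _ i x y => st o i x y (un m) [::] [::] [::] [::] [::] [::]
  nm g n2 [::]) _ (fun=> [::]) n (m * (10 * L + 90) + 76) _ o) => //; last by lia.
move=> i o' i' ltin x y; rewrite -catA.
hseq (m * (10 * L + 20) + m + 10) @runs_parse.
hseq (m * (10 * L + 20) + 2)
  (@runs_clear AA (fun z => st o (flatten (mkseq (fun j => enc_nat (v i j)) m) ++ i')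
     x y (un m) [::] [::] z [::] [::] [::] nm g n2 [::]) (un m)) => //; last by rewrite size_nseq; lia.
apply: (@runs_for_io MM TM _ (fun _ i' z w => st o i' x y z w [::] [::] [::] [::] [::]
  nm g n2 [::]) _ (fun=> [::]) m (10 * L + 10) _ o) => //; last by lia.
move=> j o2 i2 ltjm z w; apply: runs_skip_nat.
by have := HL i j ltin ltjm; lia.
Qed.

Definition read_bit :=
  let pop := HCase IN HSkip HSkip HSkip in
  HCase IN HSkip pop (pop ;; pop ;; pop ;; hfor TN TB (HPush AA true)).

Lemma runs_read_block n (b : nat -> bool) o inp m tm nm g n2 u :
  n * (5 * n + 20) + 2 <= u ->
  runs (hfor NN TN read_bit)
    (st o (flatten (mkseq (fun i => enc_nat (b i)) n) ++ inp) (un n) [::] m tm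
       [::] [::] [::] [::] [::] nm g n2 [::])
    (st o inp (un n) [::] m tm [::] (un (\sum_(i < n) b i * i)) [::] [::] [::] nm g n2 [::]) u.
Proof.
move=> Hu.
have := @runs_for NN TN read_bit (fun k x y => st o
  (flatten [seq enc_nat (b i) | i <- iota k (n - k)] ++ inp) x y m tm
  [::] (un (\sum_(i < k) b i * i)) [::] [::] [::] nm g n2 [::]) n (5 * n + 16) u.
rewrite subn0 subnn big_ord0; apply=> //; last by lia.
move=> k ltkn; have sumS : \sum_(i < k.+1) b i * i = \sum_(i < k) b i * i + b k * k by rewrite big_ord_recr.
rewrite (iota_subS ltkn) sumS [map _ _]/= [flatten _]/= => x y.
apply: (@runs_leq _ _ _ (5 * k + 16)); first by lia.
case: (b k); last first.
  by rewrite mul0n addn0; hcons 1; hcons 0; apply: runs_skip.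
rewrite mul1n.
hcons (5 * k + 15).
eapply (runs_seq (t := 1) (t1 := 5 * k + 14)); [by hcons 0; apply: runs_skip | hnorm | lia].
eapply (runs_seq (t := 1) (t1 := 5 * k + 13)); [by hcons 0; apply: runs_skip | hnorm | lia].
eapply (runs_seq (t := 1) (t1 := 5 * k + 12)); [by hcons 0; apply: runs_skip | hnorm | lia].
rewrite addnC.
apply: (@runs_for TN TB _ (fun j z w => st o (flatten [seq enc_nat (b i) | i <- iota k.+1 (n - k.+1)] ++ inp)
  x z m tm [::] (un (j + \sum_(i < k) b i * i)) [::] [::] [::] nm g n2 w) k 1) => //.
  by move=> j _ z w; hpush.
by lia.
Qed.

Definition owners_prog :=
  hinit ;; hread ;; skip_rows ;; parse ;; hclear AA ;; emit MM ;;
  hfor MM TM (hfor NN TN read_bit ;; emitA).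

Definition owners_time N :=
  (2 * N + 4) + (200 * (N + N + 1) + ((N * (N * (10 * N + 90) + 80) + 2) +
  ((60 * (N * N) + 60) + ((N * N + 1) + ((50 * N + 20) +
  (N * ((N * (5 * N + 20) + 2) + (40 * (N * N) + 5) + 4) + 2)))))).

Lemma poly_bounded_owners_time : poly_bounded owners_time.
Proof.
rewrite /owners_time.
do ![ exact: poly_bounded_id | exact: poly_bounded_const
    | apply: poly_bounded_add | apply: poly_bounded_mul ].
Qed.

Definition alloc_code m n (x : nat -> bool) : seq bool :=
  enc_nat (m * n) ++
  flatten (mkseq (fun j => flatten (mkseq (fun i => enc_nat (x (j * n + i))) n)) m).

Lemma runs_owners_prog n m (v : nat -> nat -> nat) (x : nat -> bool) N :
  n <= N -> m <= N -> (forall i j, i < n -> j < m -> size (enc_nat (v i j)) <= N) ->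
  size (priv_code n m v ++ alloc_code m n x) <= N ->
  exists s, runs owners_prog [:: rev (priv_code n m v ++ alloc_code m n x)] s (owners_time N) /\
    get s 0 = rev (enc_nat m ++
      flatten (mkseq (fun j => enc_nat (\sum_(i < n) x (j * n + i) * i)) m)).
Proof.
move=> nN mN vN cN.
have sumN j : \sum_(i < n) x (j * n + i) * i <= N * N.
  apply: (@leq_trans (\sum_(i < n) N)); last by rewrite sum_nat_const card_ord; mono.
  by apply: leq_sum => i _; have := ltn_ord i; case: (x _); lia.
have codeE c : priv_code n m v ++ c = enc_nat n ++ enc_nat m ++ enc_nat n ++ (flatten
    (mkseq (fun i => enc_nat m ++ flatten (mkseq (fun j => enc_nat (v i j)) m)) n) ++ c).
  by rewrite /priv_code -!catA.
eexists; split.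
- rewrite /owners_time.
  eapply runs_seq; [| | exact: leqnn]; [apply: runs_leq (runs_init _); mono | hnorm].
  rewrite codeE; hstep @runs_read.
  hstep (@runs_skip_rows n m N v).
  hstep @runs_parse.
  eapply runs_seq; [| | exact: leqnn].
    apply: (@runs_clear AA (fun z => st [::] (flatten (mkseq (fun j => flatten (mkseq
      (fun i => enc_nat (x (j * n + i))) n)) m)) (un n) [::] (un m) [::] [::] z [::] [::] [::]
      [::] [::] (un n) [::])) => //.
    by rewrite size_nseq addn1 ltnS; mono.
  hnorm; hstep @runs_emit_M.
  rewrite -[flatten _]cats0.
  apply: (@runs_for_io MM TM _ (fun o i z w => st o i (un n) [::] z w [::] [::] [::] [::] [::]
    [::] [::] (un n) [::]) _ (fun j => enc_nat (\sum_(i < n) x (j * n + i) * i)) m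
    ((N * (5 * N + 20) + 2) + (40 * (N * N) + 5))) => //; last by mono.
  move=> j o i ltjm z w.
  eapply runs_seq; [| | exact: leqnn].
    apply: (@runs_read_block n (fun i => x (j * n + i))); mono.
  by apply: runs_emitA; mono.
- by rewrite /= /rev !catrev_catl.
Qed.

Lemma poly_time_owners :
  poly_time (fun p : priv_inst * seq bool => enc_priv p.1 ++ enc_pub_alloc p.2)
    enc_priv_alloc (fun p => priv_wf p.1 /\ pub_MNW (reduction p.1) p.2)
    (fun p => owners p.1 p.2).
Proof.
apply: (@poly_time_hprog _ _ _ _ _ _ owners_prog _ _ poly_bounded_owners_time) => //.
move=> [I x] /= [wfI [[/= sx _] _]]; have [n0 _] := wfI.
rewrite enc_privE //.
have [nN mN vN] := priv_code_bounds (pr_m I) (Defs.val (pr_v I)) n0.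
have -> : enc_pub_alloc x = alloc_code (pr_m I) (pr_n I) (nth false x).
  by rewrite /enc_pub_alloc -{1}(mkseq_nth false x) sx enc_seq_mkseq flatten_mkseqM.
rewrite /enc_priv_alloc enc_seq_mkseq.
set p := priv_code _ _ _; set c := alloc_code _ _ _.
have pc : size p <= size (p ++ c) by rewrite size_cat leq_addr.
have [s [[t tN H] E]] := @runs_owners_prog (pr_n I) (pr_m I) (Defs.val (pr_v I)) (nth false x) _
  (leq_trans nN pc) (leq_trans mN pc) (fun i j Hi Hj => leq_trans (vN i j Hi Hj) pc) (leqnn _).
by exists t, s.
Qed.

Theorem theorem2 :
  exists (R : priv_inst -> pub_inst) (D : priv_inst -> seq bool -> seq nat),
    poly_time enc_priv enc_pub priv_wf R /\
    poly_time (fun p : priv_inst * seq bool => enc_priv p.1 ++ enc_pub_alloc p.2)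
              enc_priv_alloc
              (fun p => priv_wf p.1 /\ pub_MNW (R p.1) p.2)
              (fun p => D p.1 p.2) /\
    (forall I, priv_wf I ->
       pub_wf (R I) /\ (forall x, pub_MNW (R I) x -> priv_MNW I (D I x))).
Proof.
exists reduction, owners; split; first exact: poly_time_reduction.
split; first exact: poly_time_owners.
by move=> I wfI; split; [apply: reduction_wf | apply: reduction_correct; case: wfI].
Qed.
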